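(* For every $v\equiv 5\pmod{20}$ with $v>5$, there exists a super-simple $2$-$(v,5,1)$DD $\mathcal{D}$ with $f(\mathcal{D})\geq\frac12$.
   Context: A $2$-$(v,5,1)$ directed design ($2$-$(v,5,1)$DD) is a pair $(V,\mathcal{B})$ where $|V|=v$ and $\mathcal{B}$ is a collection of ordered $5$-tuples of distinct elements of $V$ (blocks) such that every ordered pair $(x,y)$ of distinct elements of $V$ occurs in exactly one block as a subsequence. It is super-simple if, after forgetting the order in blocks (giving a $2$-$(v,5,2)$-BIBD), any two blocks intersect in at most two points. A defining set of a $2$-$(v,5,1)$DD $\mathcal{D}=(V,\mathcal{B})$ is a subset $S\subseteq\mathcal{B}$ such that $\mathcal{D}$ is the unique $2$-$(v,5,1)$DD on $V$ whose block collection contains $S$. Define $f(\mathcal{D})$ as the number of blocks in a smallest defining set of $\mathcal{D}$ divided by $|\mathcal{B}|$. *)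

(* Defs.v *)
From HB Require Import structures.
From mathcomp Require Import all_boot all_order all_algebra.

Set Implicit Arguments.
Unset Strict Implicit.
Unset Printing Implicit Defensive.

Import Order.TTheory GRing.Theory Num.Theory.
Local Open Scope ring_scope.

(* The blocks form a set: a block repeated in the collection would cover each
   of its ordered pairs twice, so nothing is lost with respect to multisets. *)
Definition directed_design (v : nat) (V : finType) (B : {set 5.-tuple V}) : bool :=
  [&& #|V| == v,
      [forall b in B, uniq b] &
      [forall x : V, forall y : V, (x != y) ==>
         (#|[set b in B | subseq [:: x; y] b]| == 1%N)]].

(* Distinct ordered blocks with the same points are two (repeated) blocks of
   the underlying BIBD, so they are compared as well. *)
Definition super_simple (V : finType) (B : {set 5.-tuple V}) : bool :=
  [forall b in B, forall c in B, (b != c) ==> (#|[set:: b] :&: [set:: c]| <= 2)%N].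

Definition defining_set (v : nat) (V : finType) (B S : {set 5.-tuple V}) : bool :=
  (S \subset B) &&
  [forall B' : {set 5.-tuple V},
     directed_design v B' && (S \subset B') ==> (B' == B)].

Lemma defining_set_self (v : nat) (V : finType) (B : {set 5.-tuple V}) :
  directed_design v B -> defining_set v B B.
Proof.
case/and3P=> _ _ /forallP covB; rewrite /defining_set subxx /=.
apply/forallP=> B'; apply/implyP=> /andP[/and3P[_ /forallP uB' /forallP covB'] sBB'].
rewrite eqEsubset sBB' andbT; apply/subsetP=> b bB'.
have ub : uniq b by have /implyP/(_ bB') := uB' b.
have [x [y [xy sb]]] : exists x y, x != y /\ subseq [:: x; y] b.
  case/tupleP: b ub {bB'} => x b; case/tupleP: b => y b /=.
  rewrite inE negb_or => /andP[/andP[xy _] _].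
  by exists x, y; split=> //; rewrite !eqxx sub0seq.
have /forallP/(_ y)/implyP/(_ xy)/cards1P[c Ec] := covB x.
have /forallP/(_ y)/implyP/(_ xy)/cards1P[d Ed] := covB' x.
have : c \in [set c] by rewrite inE.
rewrite -Ec inE => /andP[cB sc].
have : c \in [set d] by rewrite -Ed inE (subsetP sBB' _ cB).
have : b \in [set d] by rewrite -Ed inE bB'.
by rewrite !inE => /eqP-> /eqP<-.
Qed.

(* The default B of the arg min is itself a defining set when B is a design
   (defining_set_self), so the minimum ranges over a nonempty family. *)
Definition min_defining_size (v : nat) (V : finType) (B : {set 5.-tuple V}) : nat :=
  #|[arg min_(S < B | defining_set v B S) #|S|]|.

Definition f (v : nat) (V : finType) (B : {set 5.-tuple V}) : rat :=
  (min_defining_size v B)%:R / #|B|%:R.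

(* Main.v *)
Require Import Defs.
From HB Require Import structures.
From Stdlib Require Import NArith.
From mathcomp Require Import all_boot all_order all_fingroup all_algebra all_field zify ring.

(* A design in which every block [b] has a partner [t b], [t] injective, such that
   some two points are consecutive in both blocks but in opposite orders, satisfies
   [f >= 1/2]: exchanging the two points in both blocks gives another directed
   design, so a defining set contains [b] or [t b] for every [b].

   Such designs are built recursively.  Decompositions of complete multipartite
   graphs into directed blocks with partners, any two blocks having at most two
   common points, can be inflated by orthogonal arrays, and their parts, together
   with a few more points, can be filled with smaller decompositions.  If
   [m] and [t] give designs on [20 m + 5] and [20 t + 5] points, then a transversal
   design TD(6, 5 m + 1) with one truncated group gives a design on
   [20 (5 m + 1 + t) + 5] points; this leaves finitely many orders, which reduce to
   a few designs that are found by computer and checked by evaluation. *)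

Set Implicit Arguments.
Unset Strict Implicit.
Unset Printing Implicit Defensive.

Import Order.TTheory GRing.Theory Num.Theory.

(** All ingredients are edge decompositions of simple graphs, each edge being covered in both
    orders. Blocks from edge-disjoint graphs share at most one point, so gluing never endangers
    super-simplicity; it has to be checked only inside each ingredient.

    The recursion rests on [20 m + 5 = 4 (5 m + 1) + 1]: giving weight 4 to the points of the
    transversal design, whose last group is cut to [5 t + 1] points, requires only multipartite
    decompositions with 5 or 6 parts of size 4, and one extra point completes every part to an order
    already settled.

    The obstacle is the supply of arrays with 6 columns. Fields and products give them for products
    of prime powers that are at least 5, in particular for sizes coprime to 6, and [5 m + 1] is not
    always such a size. This is why groups of size [5 m], with auxiliary orders [20 m + 1], are used
    as well, and why some orders need their own construction. *)

Section Families.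
Variables (V I : finType).
Implicit Types (b : I -> 'I_5 -> V) (E : rel V).

Definition blk (g : 'I_5 -> V) : 5.-tuple V := [tuple g p | p < 5].

Lemma tnth_blk g p : tnth (blk g) p = g p.
Proof. by rewrite tnth_mktuple. Qed.

Lemma nth_blk x0 g (p : 'I_5) : nth x0 (blk g) p = g p.
Proof. by rewrite -tnth_nth tnth_blk. Qed.

Lemma blk_uniq g : uniq (blk g) <-> injective g.
Proof.
split=> [/tuple_uniqP inj p q e|inj]; first by apply: inj; rewrite !tnth_blk.
by apply/tuple_uniqP=> p q; rewrite !tnth_blk; apply: inj.
Qed.

Lemma mem_blk g x : reflect (exists p, g p = x) (x \in val (blk g)).
Proof.
apply: (iffP (tnthP (blk g) x)) => [] [p e]; exists p; first by rewrite e tnth_blk.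
by rewrite tnth_blk.
Qed.

Lemma subseq_blk g x y : injective g -> x != y ->
  reflect (exists p q : 'I_5, [/\ p < q, g p = x & g q = y]) (subseq [:: x; y] (blk g)).
Proof.
move=> gI xy; have ug : uniq (blk g) by apply/blk_uniq.
have idx (p : 'I_5) : index (g p) (blk g) = p.
  by rewrite -(nth_blk x) index_uniq ?size_tuple.
have -> : subseq [:: x; y] (blk g) = mem2 (blk g) x y by rewrite mem2E (negPf xy).
apply: (iffP idP) => [m|[p [q [pq <- <-]]]]; last first.
  rewrite /mem2 idx; apply/(nthP x); exists (q - p).
    by rewrite size_drop size_tuple ltn_sub2r // (leq_ltn_trans _ (ltn_ord q)).
  by rewrite nth_drop subnKC ?nth_blk // ltnW.
have /mem_blk[p Ep] := mem2l m.
move: m; rewrite /mem2 -Ep idx => /(nthP x)[k]; rewrite size_drop size_tuple => kp.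
rewrite nth_drop => Eq; have kq : p + k < 5 by rewrite -ltn_subRL.
exists p, (Ordinal kq); rewrite -(nth_blk x _ (Ordinal kq)) /=; split=> //.
rewrite -[X in X < _]addn0 ltn_add2l lt0n; apply/eqP=> k0.
by move: xy; rewrite -Ep -Eq k0 addn0 nth_blk eqxx.
Qed.

(** For irreflexive [E] the first clause makes every block injective, so the last clause only has to
    identify the block: the positions follow. *)
Definition covers b E : Prop :=
  [/\ forall i (p q : 'I_5), p < q -> E (b i p) (b i q),
      forall x y, E x y -> exists i (p q : 'I_5), [/\ p < q, b i p = x & b i q = y]
    & forall i i' (p q p' q' : 'I_5), p < q -> p' < q' ->
        b i p = b i' p' -> b i q = b i' q' -> i = i'].

(** Distinctness is asked on one side only; for injective blocks the equations transfer it to the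
    other side. The conclusion also excludes two blocks on the same five points. *)
Definition super_simple_family b : Prop :=
  forall i i' (p q r p' q' r' : 'I_5), uniq [:: p; q; r] ->
    b i p = b i' p' -> b i q = b i' q' -> b i r = b i' r' -> i = i'.

(* Two blocks share a pair of points that is consecutive in both of them, in
   opposite orders: exchanging the two points in both blocks is a trade. *)
Definition trade (g h : 'I_5 -> V) : Prop :=
  exists p q p' q' : 'I_5,
    [/\ q = p.+1 :> nat, q' = p'.+1 :> nat, g p = h q' & g q = h p'].

End Families.

(** The partner map is an injection rather than an involution: inflation chooses the partner of a
    block through a row of an array, and injectivity is what the final count uses. *)
Definition good (V : finType) (E : rel V) : Prop :=
  exists (I : finType) (b : I -> 'I_5 -> V) (t : I -> I),
    [/\ covers b E, super_simple_family b, injective t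
      & forall i, trade (b i) (b (t i))].

Definition complete (V : finType) : rel V := fun x y => x != y.

Lemma ord_neq_lt n (p q : 'I_n) : p != q -> (p < q) || (q < p).
Proof. by rewrite -neq_ltn. Qed.

(** * From covering families to super-simple directed designs *)

Section Design.
Variables (V I : finType) (b : I -> 'I_5 -> V).
Hypothesis cov : covers b (@complete V).

Lemma cover_inj i : injective (b i).
Proof.
case: cov => sub _ _ p q e; apply/eqP/negP=> /negP /ord_neq_lt /orP[] /(sub i).
  by rewrite /complete e eqxx.
by rewrite /complete e eqxx.
Qed.

Definition design : {set 5.-tuple V} := [set blk (b i) | i : I].

Lemma design_dd : directed_design #|V| design.
Proof.
rewrite /directed_design eqxx /=; apply/andP; split.
  apply/forallP=> c; apply/implyP=> /imsetP[i _ ->].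
  exact/blk_uniq/cover_inj.
apply/forallP=> x; apply/forallP=> y; apply/implyP=> xy.
case: cov => _ ex un; have [i [p [q [pq ep eq]]]] := ex x y xy.
apply/cards1P; exists (blk (b i)); apply/setP=> c; rewrite !inE.
apply/andP/eqP=> [[/imsetP[j _ ->]]|->]; last first.
  split; first exact: imset_f.
  by apply/(subseq_blk (@cover_inj i) xy); exists p, q.
move/(subseq_blk (@cover_inj j) xy) => [p' [q' [pq' ep' eq']]].
by rewrite (un i j p q p' q') // ?ep ?eq.
Qed.

Hypothesis ss : super_simple_family b.

Lemma blk_same i j : blk (b i) = blk (b j) -> i = j.
Proof.
move=> e; have same p : b i p = b j p by rewrite -tnth_blk e tnth_blk.
pose o k := @Ordinal 5 k.
exact: (@ss i j (o 0 isT) (o 1 isT) (o 2 isT)) (same _) (same _) (same _).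
Qed.

Lemma design_super_simple : super_simple design.
Proof.
apply/forallP=> c; apply/implyP=> /imsetP[i _ ->].
apply/forallP=> d; apply/implyP=> /imsetP[j _ ->]; apply/implyP=> bij.
rewrite leqNgt; apply: contra bij => /card_gt2P[x [y [z [[]]]]].
rewrite !inE => /andP[/mem_blk[p <-] /mem_blk[p' e1]].
move=> /andP[/mem_blk[q <-] /mem_blk[q' e2]].
move=> /andP[/mem_blk[r <-] /mem_blk[r' e3]] [n1 n2 n3].
rewrite (@ss i j p q r p' q' r') //= !inE andbT negb_or.
have neq s s' : b i s != b i s' -> s != s' by apply: contraNneq => ->.
by rewrite (neq _ _ n1) (neq _ _ n2) [p == r]eq_sym (neq _ _ n3).
Qed.

End Design.

(** * Exchanging two consecutive points of a block *)

Definition occ (V : Type) (g : 'I_5 -> V) (x y : V) : Prop :=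
  exists p q : 'I_5, [/\ p < q, g p = x & g q = y].

(** No position lies between [p] and [q], so their exchange can reverse no other pair. *)
Lemma tperm_adj_lt (p q a c : 'I_5) : q = p.+1 :> nat -> a < c ->
  ~~ ((a == p) && (c == q)) -> tperm p q a < tperm p q c.
Proof.
have V (x y : 'I_5) : x <> y -> x <> y :> nat by move=> n /val_inj.
move=> qp ac; case: (tpermP p q a) => [ea|ea|/V na1 /V na2];
  case: (tpermP p q c) => [ec|ec|/V nc1 /V nc2]; rewrite ?ea ?ec ?eqxx // in ac *;
  lia.
Qed.

Lemma occ_tperm (V : Type) (g : 'I_5 -> V) (p q : 'I_5) x y :
  injective g -> q = p.+1 :> nat -> (x, y) <> (g p, g q) ->
  occ g x y -> occ (g \o tperm p q) x y.
Proof.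
move=> gI qp ne [a [c [ac ea ec]]]; exists (tperm p q a), (tperm p q c).
rewrite /= !tpermK; split=> //; apply: tperm_adj_lt => //.
by apply/negP=> /andP[/eqP ep /eqP eq]; apply: ne; rewrite -ea -ec ep eq.
Qed.

Lemma occ_tperm_rev (V : Type) (g : 'I_5 -> V) (p q : 'I_5) :
  q = p.+1 :> nat -> occ (g \o tperm p q) (g q) (g p).
Proof. by move=> qp; exists p, q; rewrite /= tpermL tpermR qp. Qed.

Lemma tperm_inj (V : Type) (g : 'I_5 -> V) p q :
  injective g -> injective (g \o tperm p q).
Proof. by move=> gI; apply: inj_comp gI (@perm_inj _ _). Qed.

Lemma occ_tpermE (V : Type) (g : 'I_5 -> V) (p q : 'I_5) x y :
  injective g -> q = p.+1 :> nat -> occ (g \o tperm p q) x y ->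
  x = g q /\ y = g p \/ occ g x y /\ ~ (x = g p /\ y = g q).
Proof.
move=> gI qp [a [c [ac <- <-]]] /=.
have [/andP[/eqP-> /eqP->]|n] := boolP ((a == p) && (c == q)).
  by left; rewrite tpermL tpermR.
right; split; first by exists (tperm p q a), (tperm p q c); rewrite tperm_adj_lt.
case=> /gI e1 /gI e2; move: ac; rewrite -(tpermK p q a) -(tpermK p q c) e1 e2.
by rewrite tpermL tpermR qp ltnNge leqnSn.
Qed.

(** * Trades and the lower bound on defining sets *)

Section LowerBound.
Variables (V I : finType) (b : I -> 'I_5 -> V).
Hypotheses (cov : covers b (@complete V)) (ss : super_simple_family b).

Let bI := cover_inj cov.

Lemma cover_occ x y : x != y -> exists i, occ (b i) x y.
Proof.
by case: cov => _ ex _ /ex[i [p [q [pq <- <-]]]]; exists i, p, q.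
Qed.

Lemma occ_unique i j x y : occ (b i) x y -> occ (b j) x y -> i = j.
Proof.
case: cov => _ _ un [p [q [pq ex ey]]] [p' [q' [pq' ex' ey']]].
by apply: (un i j p q p' q'); rewrite ?ex ?ey.
Qed.

Lemma occ_cover (c : I -> 'I_5 -> V) : (forall i, injective (c i)) ->
  (forall x y, x != y -> exists i, occ (c i) x y) ->
  (forall i j x y, occ (c i) x y -> occ (c j) x y -> i = j) ->
  covers c (@complete V).
Proof.
move=> cI ex un; split.
- move=> i p q pq; apply/eqP=> /cI e; by rewrite e ltnn in pq.
- by move=> x y /ex[i [p [q [? ? ?]]]]; exists i, p, q.
- move=> i j p q p' q' pq pq' e1 e2; apply: (un i j (c i p) (c i q)).
    by exists p, q.
  by exists p', q'; rewrite e1 e2.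
Qed.

Variables (i0 j0 : I).
Hypothesis tr : trade (b i0) (b j0).

(** Inside a single block two points cannot occur in both orders. *)
Lemma trade_neq : i0 != j0.
Proof.
case: tr => p [q [p' [q' [qp qp' e1 e2]]]]; apply/eqP=> ij; rewrite -ij in e1 e2.
by move/bI: e1; move/bI: e2 => e2 e1; move: qp; rewrite e2 e1 qp'; lia.
Qed.

(** Only two ordered pairs, the reverses of each other, change blocks, and they swap places; every
    ordered pair therefore stays covered once. The last clause records that block [i0] has really
    changed. *)
Lemma trade_covers : exists c : I -> 'I_5 -> V,
  [/\ covers c (@complete V), forall i, i != i0 -> i != j0 -> c i = b i
    & exists p q, p != q /\ c i0 = b i0 \o tperm p q].
Proof.
case: tr => p [q [p' [q' [qp qp' e1 e2]]]].
have ij := trade_neq.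
pose c i := if i == i0 then b i \o tperm p q else
            if i == j0 then b i \o tperm p' q' else b i.
have ci0 : c i0 = b i0 \o tperm p q by rewrite /c eqxx.
have cj0 : c j0 = b j0 \o tperm p' q' by rewrite /c eq_sym (negPf ij) eqxx.
have cI i : injective (c i).
  rewrite /c; case: ifP => _; first exact: tperm_inj.
  by case: ifP => _ //; apply: tperm_inj.
have pq : p != q by rewrite -val_eqE /= qp; lia.
have o0 : occ (b i0) (b i0 p) (b i0 q) by exists p, q; rewrite qp.
have o1 : occ (b j0) (b i0 q) (b i0 p) by exists p', q'; rewrite qp' e1 e2.
have oc0 : occ (c i0) (b i0 q) (b i0 p) by rewrite ci0; apply: occ_tperm_rev.
have oc1 : occ (c j0) (b i0 p) (b i0 q).
  by rewrite cj0 e1 e2; apply: occ_tperm_rev.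
(* A pair of the new family is one of the two exchanged pairs, now in the other block, or an old
   pair that keeps its block. *)
have ocE i x y : occ (c i) x y ->
  [\/ [/\ i = j0, x = b i0 p & y = b i0 q],
      [/\ i = i0, x = b i0 q & y = b i0 p]
    | [/\ occ (b i) x y, ~ (x = b i0 p /\ y = b i0 q) &
          ~ (x = b i0 q /\ y = b i0 p)]].
  have [->|ni0] := eqVneq i i0.
    rewrite ci0 => /(occ_tpermE (@bI _) qp)[[-> ->]|[o n]]; first by constructor 2.
    constructor 3; split=> // -[ex ey]; case/eqP: ij.
    by apply: (occ_unique o); rewrite ex ey.
  have [->|nj0] := eqVneq i j0.
    rewrite cj0 => /(occ_tpermE (@bI _) qp')[[-> ->]|[o]].
      by constructor 1.
    rewrite -e1 -e2 => n; constructor 3; split=> //.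
    move=> [ex ey]; case/eqP: ij; apply: occ_unique o0 _; by rewrite -ex -ey.
  rewrite /c (negPf ni0) (negPf nj0) => o; constructor 3; split=> // -[ex ey].
    by case/eqP: ni0; apply: (occ_unique o); rewrite ex ey.
  by case/eqP: nj0; apply: (occ_unique o); rewrite ex ey.
exists c; split; last by exists p, q.
  apply: occ_cover => //.
    move=> x y xy.
    have [/andP[/eqP-> /eqP->]|n1] := boolP ((x == b i0 p) && (y == b i0 q)).
      by exists j0.
    have [/andP[/eqP-> /eqP->]|n2] := boolP ((x == b i0 q) && (y == b i0 p)).
      by exists i0.
    have [i o] := cover_occ xy; exists i.
    have [ii|ni0] := eqVneq i i0.
      rewrite ii ci0 in o *; apply: occ_tperm => //.
      by move=> [ex ey]; move: n1; rewrite ex ey !eqxx.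
    have [ii|nj0] := eqVneq i j0.
      rewrite ii cj0 in o *; apply: occ_tperm => //.
      by move=> [ex ey]; move: n2; rewrite ex ey -e1 -e2 !eqxx.
    by rewrite /c (negPf ni0) (negPf nj0).
  move=> i j x y /ocE[[-> ex ey]|[-> ex ey]|[o n1 n2]].
  - case/ocE=> [[-> //]|[_ ex' ey']|[_ n _]]; last by case: n.
    by move/eqP: pq; case; apply: (@bI i0); rewrite -ex ex'.
  - case/ocE=> [[_ ex' ey']|[-> //]|[_ _ n]]; last by case: n.
    by move/eqP: pq; case; apply: (@bI i0); rewrite -ex' ex.
  - case/ocE=> [[_ ex' ey']|[_ ex' ey']|[o' _ _]]; [by case: n1|by case: n2|].
    exact: occ_unique o o'.
by move=> i n1 n2; rewrite /c (negPf n1) (negPf n2).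
Qed.

(** If [S] avoided both blocks, it would also lie in the traded design, which would then have to
    equal the original one. *)
Lemma defining_hits (S : {set 5.-tuple V}) :
  defining_set #|V| (design b) S -> (blk (b i0) \in S) || (blk (b j0) \in S).
Proof.
case/andP=> sub /forallP def; apply/negP=> /negP; rewrite negb_or => /andP[ni nj].
have [c [cc cE [p [q [pq c0]]]]] := trade_covers.
have /implyP := def (design c); rewrite (design_dd cc) /= => H.
have /H /eqP E : S \subset design c.
  apply/subsetP=> s sS; have /imsetP[i _ si] := subsetP sub s sS.
  apply/imsetP; exists i => //; rewrite cE //.
    by apply: contraNneq ni => <-; rewrite -si.
  by apply: contraNneq nj => <-; rewrite -si.
have : blk (c i0) \in design c by apply: imset_f.
rewrite E => /imsetP[i _ e].
have same r : b i0 (tperm p q r) = b i r.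
  by rewrite -[RHS]tnth_blk -e tnth_blk c0.
pose o k := @Ordinal 5 k.
(* The traded block has the points of the old block [i0], so by super-simplicity no other old block
   can equal it; but its order differs from that of [i0]. *)
have ii : i0 = i.
  pose s := tperm p q.
  apply: (@ss i0 i (s (o 0 isT)) (s (o 1 isT)) (s (o 2 isT))) (same _) (same _) (same _).
  by rewrite -[[:: _; _; _]]/(map s [:: o 0 isT; o 1 isT; o 2 isT]) (map_inj_uniq perm_inj).
have := same p; rewrite -ii tpermL => /bI qp; by rewrite qp eqxx in pq.
Qed.

End LowerBound.

Lemma good_complete_attains (V : finType) : 1 < #|V| -> good (@complete V) ->
  exists B : {set 5.-tuple V},
    [/\ directed_design #|V| B, super_simple B & (1 / 2 <= f #|V| B)%R].
Proof.
move=> V2 [I [b [t [cov ss tI tr]]]]; exists (design b); split.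
- exact: design_dd.
- exact: design_super_simple.
rewrite /f /min_defining_size.
case: arg_minnP => [|S dS _]; first by apply: defining_set_self; apply: design_dd.
set J := [set i | blk (b i) \in S].
have bI : injective (fun i => blk (b i)) by move=> i j; apply: blk_same.
have cJ : #|J| <= #|S|.
  rewrite -(card_imset J bI); apply: subset_leq_card.
  by apply/subsetP=> s /imsetP[i]; rewrite inE => ? ->.
have cD : #|design b| = #|I| by rewrite card_imset.
have cI : #|I| <= #|S| + #|S|.
  apply: leq_trans (leq_add cJ cJ); rewrite -[X in _ <= _ + X](card_preimset J tI).
  apply: leq_trans (leq_card_setU _ _); rewrite -cardsT; apply: subset_leq_card.
  apply/subsetP=> i _; rewrite !inE; exact: (defining_hits cov ss (tr i)) dS.
(* A quotient by zero is zero, so the bound on [f] needs a design with at least one block; two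
   distinct points provide it. *)
have I0 : 0 < #|I|.
  have [x [y [_ _ /(cover_occ cov)[i _]]]] : exists x y, [/\ x \in V, y \in V & x != y].
    by case/card_gt1P: V2 => x [y [? ? ?]]; exists x, y.
  by apply/card_gt0P; exists i.
rewrite cD ler_pdivlMr ?ltr0n // mul1r ler_pdivrMl ?ltr0n //.
by rewrite -natrM ler_nat mul2n -addnn.
Qed.

(** * Gluing decompositions of edge-disjoint graphs *)

Definition sgraph (V : Type) (E : rel V) : Prop := irreflexive E /\ symmetric E.

Lemma covers_adj (V I : finType) (b : I -> 'I_5 -> V) (E : rel V) i p q :
  sgraph E -> covers b E -> p != q -> E (b i p) (b i q).
Proof.
move=> [_ Es] [sub _ _] /ord_neq_lt/orP[] /(sub i) //.
by rewrite Es.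
Qed.

Lemma covers_inj (V I : finType) (b : I -> 'I_5 -> V) (E : rel V) i :
  sgraph E -> covers b E -> injective (b i).
Proof.
move=> sE cov p q e; apply/eqP/negPn/negP=> /(covers_adj i sE cov).
by rewrite e; case: sE => ->.
Qed.

Lemma good_eq (V : finType) (E E' : rel V) : E =2 E' -> good E -> good E'.
Proof.
move=> eE [I [b [t [[sub ex un] ss tI tr]]]]; exists I, b, t; split=> //; split=> //.
- by move=> i p q pq; rewrite -eE sub.
- by move=> x y; rewrite -eE; apply: ex.
Qed.

(* Two points determine the copy they come from, so blocks of distinct copies
   meet in at most one point and super-simplicity is preserved. *)
Lemma good_images (K V W : finType) (E : rel W) (E' : rel V) (h : K -> W -> V) :
  sgraph E -> (forall k, injective (h k)) ->
  (forall k k' x y x' y', E x y -> E x' y' -> h k x = h k' x' -> h k y = h k' y' ->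
     k = k') ->
  (forall k x y, E x y -> E' (h k x) (h k y)) ->
  (forall u v, E' u v -> exists k x y, [/\ E x y, h k x = u & h k y = v]) ->
  good E -> good E'.
Proof.
move=> sE hI hD hE hE' [I [b [t [cov ss tI tr]]]].
have bI i : injective (b i) := @covers_inj _ _ b E i sE cov.
have adj i p q : p != q -> E (b i p) (b i q) := @covers_adj _ _ b E i p q sE cov.
case: (cov) => sub ex un.
exists (K * I)%type, (fun ki p => h ki.1 (b ki.2 p)), (fun ki => (ki.1, t ki.2)).
split; first split.
- by move=> [k i] p q pq /=; apply/hE/sub.
- move=> u v /hE'[k [x [y [/ex[i [p [q [pq <- <-]]]] <- <-]]]].
  by exists (k, i), p, q.
- move=> [k i] [k' i'] p q p' q' pq pq' /= e1 e2.
  have kk : k = k' by apply: hD e1 e2; apply: sub.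
  rewrite -kk in e1 e2 *; congr (_, _).
  exact: un pq pq' (hI k _ _ e1) (hI k _ _ e2).
- move=> [k i] [k' i'] p q r p' q' r' pqr /= e1 e2 e3.
  have pq : p != q by move: pqr; rewrite /= inE negb_or -andbA => /andP[].
  have pq' : p' != q'.
    by apply: contra_neq pq => e; apply/(bI i)/(hI k); rewrite e1 e2 e.
  have kk : k = k' by apply: hD e1 e2; apply: adj.
  rewrite -kk in e1 e2 e3 *; congr (_, _).
  exact: ss pqr (hI k _ _ e1) (hI k _ _ e2) (hI k _ _ e3).
- by move=> [k i] [k' i'] [-> /tI ->].
- by move=> [k i]; have [p [q [p' [q' [? ? /= e1 e2]]]]] := tr i;
    exists p, q, p', q'; rewrite e1 e2.
Qed.

(** Two common points of two blocks are an edge of both underlying graphs; hence blocks from the two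
    families share at most one point, which is the fact [cross]. *)
Lemma good_union (V : finType) (E1 E2 : rel V) :
  sgraph E1 -> sgraph E2 -> (forall x y, E1 x y -> ~~ E2 x y) ->
  good E1 -> good E2 -> good (fun x y => E1 x y || E2 x y).
Proof.
move=> s1 s2 dis [I1 [b1 [t1 [cov1 ss1 tI1 tr1]]]] [I2 [b2 [t2 [cov2 ss2 tI2 tr2]]]].
have adj1 i p q : p != q -> E1 (b1 i p) (b1 i q) := @covers_adj _ _ b1 E1 i p q s1 cov1.
have adj2 i p q : p != q -> E2 (b2 i p) (b2 i q) := @covers_adj _ _ b2 E2 i p q s2 cov2.
case: (cov1) (cov2) => sub1 ex1 un1 [sub2 ex2 un2].
pose b (i : I1 + I2) := match i with inl i => b1 i | inr i => b2 i end.
pose t (i : I1 + I2) := match i with inl i => inl (t1 i) | inr i => inr (t2 i) end.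
have cross i j (p q p' q' : 'I_5) : p != q ->
    b1 i p = b2 j p' -> b1 i q = b2 j q' -> False.
  move=> pq e1 e2; have a1 := adj1 i p q pq.
  have pq' : p' != q'.
    by apply: contraTneq a1 => e; rewrite e1 e2 e; case: s1 => ->.
  by move/dis/negP: a1; rewrite e1 e2; apply; apply: adj2.
have lt_neq (p q : 'I_5) : p < q -> p != q by rewrite neq_ltn => ->.
have uniq_neq (p q r : 'I_5) : uniq [:: p; q; r] -> p != q.
  by rewrite /= inE negb_or -andbA => /andP[].
exists (I1 + I2)%type, b, t; split; first split.
- by move=> [i|i] p q pq /=; rewrite ?(sub1 i) ?(sub2 i) ?orbT.
- move=> x y /orP[/ex1|/ex2] [i [p [q [? ? ?]]]].
    by exists (inl i), p, q.
  by exists (inr i), p, q.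
- move=> [i|i] [j|j] p q p' q' pq pq' /= e1 e2.
  + by rewrite (un1 i j p q p' q').
  + by case: (cross i j p q p' q'); rewrite ?lt_neq.
  + by case: (cross j i p' q' p q); rewrite ?lt_neq.
  + by rewrite (un2 i j p q p' q').
- move=> [i|i] [j|j] p q r p' q' r' pqr /= e1 e2 e3.
  + by rewrite (ss1 i j p q r p' q' r').
  + by case: (cross i j p q p' q') => //; apply: uniq_neq pqr.
  + have pq := uniq_neq _ _ _ pqr; case: (cross j i p' q' p q) => //.
    apply: contra_neq pq => e; apply: (covers_inj s2 cov2 (i := i)).
    by rewrite e1 e2 e.
  + by rewrite (ss2 i j p q r p' q' r').
- by move=> [i|i] [j|j] //= [] => [/tI1|/tI2] ->.
- by move=> [i|i] /=; [apply: tr1|apply: tr2].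
Qed.

(** * The graphs to be decomposed, and filling their parts *)

Definition multipartite (A M : finType) : rel (A * M) := fun x y => x.1 != y.1.

(** Decompositions of this graph are incomplete designs. Many copies can share the points of [Z],
    since none of them covers a pair inside [Z]. *)
Definition hole (M Z : finType) : rel (M + Z) := fun x y =>
  (x != y) && match x, y with inr _, inr _ => false | _, _ => true end.

(* The complete multipartite graph with parts of size [#|M|] indexed by [A] and one
   more part [N]. *)
Definition truncated (A M N : finType) : rel ((A * M) + N) := fun x y =>
  match x, y with
  | inl x, inl y => x.1 != y.1
  | inr _, inr _ => false
  | _, _ => true
  end.

Lemma sgraph_complete V : sgraph (@complete V).
Proof. by split=> [x|x y]; rewrite /complete ?eqxx // eq_sym. Qed.

Lemma sgraph_multipartite A M : sgraph (@multipartite A M).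
Proof. by split=> [x|x y]; rewrite /multipartite ?eqxx // eq_sym. Qed.

Lemma sgraph_hole M Z : sgraph (@hole M Z).
Proof.
split=> [x|x y]; rewrite /hole ?eqxx // eq_sym; congr (_ && _).
by case: x y => [x|x] [y|y].
Qed.

Lemma sgraph_truncated A M N : sgraph (@truncated A M N).
Proof. by split=> [[x|x]|[x|x] [y|y]]; rewrite /truncated ?eqxx // eq_sym. Qed.

Lemma good_bij (V W : finType) (E : rel W) (E' : rel V) (h : W -> V) :
  sgraph E -> bijective h -> (forall x y, E' (h x) (h y) = E x y) ->
  good E -> good E'.
Proof.
move=> sE [h' hK h'K] hE; apply: (@good_images unit V W E E' (fun=> h)) => //.
- by move=> _; apply: can_inj hK.
- by move=> [] [].
- by move=> _ x y; rewrite hE.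
- by move=> u v; exists tt, (h' u), (h' v); rewrite -hE !h'K.
Qed.

Lemma card_bij (A B : finType) : #|A| = #|B| -> exists h : A -> B, bijective h.
Proof.
move=> eAB; exists (fun a => enum_val (cast_ord eAB (enum_rank a))).
exists (fun b => enum_val (cast_ord (esym eAB) (enum_rank b))) => x.
  by rewrite enum_valK cast_ordK enum_rankK.
by rewrite enum_valK cast_ordKV enum_rankK.
Qed.

Lemma good_complete_card (V W : finType) :
  #|V| = #|W| -> good (@complete V) -> good (@complete W).
Proof.
case/card_bij=> h hB; apply: (good_bij (@sgraph_complete V) hB) => x y.
by rewrite /complete (bij_eq hB).
Qed.

Lemma good_multipartite_card (A B M N : finType) : #|A| = #|B| -> #|M| = #|N| ->
  good (@multipartite A M) -> good (@multipartite B N).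
Proof.
case/card_bij=> h hB /card_bij[k kB].
apply: (good_bij (h := fun x => (h x.1, k x.2)) (@sgraph_multipartite A M)).
  case: hB kB => h' hK h'K [k' kK k'K].
  by exists (fun x => (h' x.1, k' x.2)) => -[x y] /=; rewrite ?hK ?kK ?h'K ?k'K.
by move=> x y; rewrite /multipartite /= (bij_eq hB).
Qed.

Lemma sum_bij (A B C D : Type) (h : A -> B) (k : C -> D) : bijective h -> bijective k ->
  bijective (fun x : A + C => match x with inl a => inl (h a) | inr c => inr (k c) end).
Proof.
move=> [h' hK h'K] [k' kK k'K].
by exists (fun x => match x with inl a => inl (h' a) | inr c => inr (k' c) end)
  => -[x|x]; rewrite ?hK ?h'K ?kK ?k'K.
Qed.

Lemma good_hole_card (M N Y Z : finType) : #|M| = #|N| -> #|Y| = #|Z| ->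
  good (@hole M Y) -> good (@hole N Z).
Proof.
case/card_bij=> h hB /card_bij[k kB]; have hkB := sum_bij hB kB.
apply: (good_bij (@sgraph_hole M Y) hkB) => x y; rewrite /hole (bij_eq hkB).
by case: x y => [x|x] [y|y].
Qed.

Lemma good_truncated_card (A M N M' N' : finType) : #|M| = #|M'| -> #|N| = #|N'| ->
  good (@truncated A M N) -> good (@truncated A M' N').
Proof.
case/card_bij=> h hB /card_bij[k kB].
have hB' : bijective (fun x : A * M => (x.1, h x.2)).
  by case: hB => h' hK h'K; exists (fun x => (x.1, h' x.2)) => -[x y] /=; rewrite ?hK ?h'K.
apply: (good_bij (@sgraph_truncated A M N) (sum_bij hB' kB)) => x y.
by case: x y => [x|x] [y|y].
Qed.

Lemma good_hole_complete (M Z : finType) : #|Z| <= 1 ->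
  good (@complete (M + Z)%type) -> good (@hole M Z).
Proof.
move=> /fintype_le1P Z1; apply: good_eq => -[x|x] [y|y];
  by rewrite /complete /hole ?andbT // (Z1 x y) eqxx.
Qed.

Lemma good_multipartite_truncated (A M : finType) :
  good (@multipartite (option A) M) -> good (@truncated A M M).
Proof.
apply: (good_bij (@sgraph_multipartite _ _)
  (h := fun x => if x.1 is Some a then inl (a, x.2) else inr x.2)).
  by exists (fun x => match x with inl u => (Some u.1, u.2) | inr y => (None, y) end)
    => [[[a|] y]|[[a y]|y]].
by move=> [[a|] y] [[a'|] y'].
Qed.

(** Pairs from different parts are covered by the multipartite ingredient. Each part, together with
    the common points [Z], receives its own copy of the incomplete design. *)
Lemma good_fill_hole (A M Z : finType) :
  good (@multipartite A M) -> good (@hole M Z) -> good (@hole (A * M)%type Z).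
Proof.
pose V := ((A * M) + Z)%type.
pose across : rel V := fun x y =>
  match x, y with inl x, inl y => x.1 != y.1 | _, _ => false end.
pose within : rel V := fun x y =>
  match x, y with
  | inl x, inl y => (x.1 == y.1) && (x.2 != y.2)
  | inr _, inr _ => false
  | _, _ => true
  end.
pose inj (a : A) (x : M + Z) : V := match x with inl m => inl (a, m) | inr c => inr c end.
move=> /(@good_images unit _ _ _ across (fun=> inl) (@sgraph_multipartite _ _)) gA.
move=> /(@good_images A _ _ _ within inj (@sgraph_hole _ _)) gW.
apply: good_eq (good_union (E1 := across) (E2 := within) _ _ _ (gA _ _ _ _) (gW _ _ _ _)).
- move=> [[a x]|x] [[a' y]|y]; rewrite /hole //= ?andbF // -[inl _ == inl _]/((a, x) == (a', y)).
  by rewrite xpair_eqE; case: (a == a'); rewrite ?andbT.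
- by split=> [[x|x]|[x|x] [y|y]] //=; rewrite ?eqxx // eq_sym.
- split=> [[x|x]|[x|x] [y|y]] //=; first by rewrite !eqxx.
  by rewrite eq_sym [x.2 == _]eq_sym.
- by move=> [x|x] [y|y] //= /negPf ->.
- by move=> _ x y [].
- by move=> [] [].
- by [].
- by move=> [u|u] [v|v] //= uv; exists tt, u, v.
- by move=> a [x|x] [y|y] // [] ->.
- move=> k k' [x|x] [y|y] [x'|x'] [y'|y'] //=;
    rewrite /hole ?andbF //= => _ _ e1 e2; by [case: e1|case: e2].
- by move=> a [x|x] [y|y] //=; rewrite /hole ?andbT ?andbF //= eqxx.
- move=> [[a x]|u] [[a' y]|v] //=.
  + move=> /andP[/eqP <- xy]; exists a, (inl x), (inl y); split=> //.
    by rewrite /hole andbT; apply: contra xy => /eqP[->].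
  + by move=> _; exists a, (inl x), (inr v).
  + by move=> _; exists a', (inr u), (inl y).
Qed.

(** The pairs inside [Z] must be covered once: the parts of size [#|M|] get incomplete designs, and
    only the last part [N] gets a complete one on [N] and [Z]. *)
Lemma good_fill_truncated (A M N Z : finType) : good (@truncated A M N) -> good (@hole M Z) ->
  good (@complete (N + Z)%type) -> good (@complete (((A * M) + N) + Z)%type).
Proof.
pose V := (((A * M) + N) + Z)%type.
pose across : rel V := fun x y =>
  match x, y with inl x, inl y => truncated x y | _, _ => false end.
pose within : rel V := fun x y =>
  match x, y with
  | inl (inl x), inl (inl y) => (x.1 == y.1) && (x.2 != y.2)
  | inl (inl x), inr _ | inr _, inl (inl x) => true
  | _, _ => false
  end.
pose last : rel V := fun x y => (x != y) &&
  match x, y with inl (inl _), _ | _, inl (inl _) => false | _, _ => true end.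
pose inj (a : A) (x : M + Z) : V := match x with inl m => inl (inl (a, m)) | inr c => inr c end.
pose inj' (x : N + Z) : V := match x with inl n => inl (inr n) | inr c => inr c end.
move=> /(@good_images unit _ _ _ across (fun=> inl) (@sgraph_truncated _ _ _)) gA.
move=> /(@good_images A _ _ _ within inj (@sgraph_hole _ _)) gW.
move=> /(@good_images unit _ _ _ last (fun=> inj') (@sgraph_complete _)) gL.
have sA : sgraph across.
  by split=> [[x|x]|[x|x] [y|y]] //=; case: (@sgraph_truncated A M N).
have sW : sgraph within.
  split=> [[[x|x]|x]|[[x|x]|x] [[y|y]|y]] //=; first by rewrite !eqxx.
  by rewrite eq_sym [x.2 == _]eq_sym.
have sL : sgraph last.
  split=> [x|x y]; rewrite /last ?eqxx // eq_sym; congr (_ && _).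
  by case: x y => [[x|x]|x] [[y|y]|y].
have {}gA : good across.
  apply: gA; [by move=> _ x y []|by move=> [] []|by []|].
  by move=> [u|u] [v|v] //= uv; exists tt, u, v.
have {}gW : good within.
  apply: gW.
  - by move=> a [x|x] [y|y] // [] ->.
  - move=> k k' [x|x] [y|y] [x'|x'] [y'|y'] //=;
      rewrite /hole ?andbF //= => _ _ e1 e2; by [case: e1|case: e2].
  - by move=> a [x|x] [y|y] //=; rewrite /hole ?andbT ?andbF //= eqxx.
  - move=> [[[a x]|u]|u] [[[a' y]|v]|v] //=.
    + move=> /andP[/eqP <- xy]; exists a, (inl x), (inl y); split=> //.
      by rewrite /hole andbT; apply: contra xy => /eqP[->].
    + by move=> _; exists a, (inl x), (inr v).
    + by move=> _; exists a', (inr u), (inl y).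
have {}gL : good last.
  apply: gL; [by move=> _ [x|x] [y|y] // [->]|by move=> [] []| |].
    by move=> _ [x|x] [y|y]; rewrite /complete /last //= andbT; apply: contra => /eqP[->].
  move=> [[u|u]|u] [[v|v]|v]; rewrite /last ?andbF ?andbT // => uv;
    [exists tt, (inl u), (inl v)|exists tt, (inl u), (inr v)
    |exists tt, (inr u), (inl v)|exists tt, (inr u), (inr v)]; split=> //;
    by apply: contra uv => /eqP[->].
have sAW : sgraph (fun x y => across x y || within x y).
  by case: sA sW => i1 s1 [i2 s2]; split=> [x|x y]; rewrite ?i1 ?i2 // s1 s2.
apply: good_eq (good_union sAW sL _ (good_union sA sW _ gA gW) gL).
- move=> [[[a x]|x]|x] [[[a' y]|y]|y]; rewrite /complete /last /= ?andbF ?andbT ?orbF //.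
  rewrite -[inl (inl _) == _]/((a, x) == (a', y)) xpair_eqE.
  by case: (a == a').
- by move=> [[x|x]|x] [[y|y]|y] //=; rewrite /last ?andbF.
- by move=> [[x|x]|x] [[y|y]|y] //= /negPf ->.
Qed.

Lemma good_fill_complete (A M Z : finType) : good (@multipartite (option A) M) ->
  good (@hole M Z) -> good (@complete (M + Z)%type) ->
  good (@complete ((option A * M) + Z)%type).
Proof.
move=> /good_multipartite_truncated gT gH gC.
apply: good_complete_card (good_fill_truncated gT gH gC).
by rewrite !card_sum !card_prod card_option mulSn [#|M| + _]addnC.
Qed.

(** * Orthogonal arrays *)

(* An orthogonal array of strength 2 and index 1 with [c] columns, i.e. a
   transversal design TD(c, #|Q|); [ev g i] is the entry of row [g] in column [i]. *)
Definition rows_determined (c : nat) (Q G : finType) (ev : G -> 'I_c -> Q) : Prop :=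
  forall i j g h, i != j -> ev g i = ev h i -> ev g j = ev h j -> g = h.

Definition is_oa (c : nat) (Q G : finType) (ev : G -> 'I_c -> Q) : Prop :=
  #|G| = #|Q| * #|Q| /\ rows_determined ev.

Definition oa (c n : nat) : Prop :=
  exists (Q G : finType) (ev : G -> 'I_c -> Q), #|Q| = n /\ is_oa ev.

(** Two distinct columns embed the rows into the pairs of symbols, and there are as many rows as
    pairs, so the embedding is onto. *)
Lemma oa_row c (Q G : finType) (ev : G -> 'I_c -> Q) i j x y :
  is_oa ev -> i != j -> exists g, ev g i = x /\ ev g j = y.
Proof.
move=> [cG det] ij.
have inj : injective (fun g => (ev g i, ev g j)) by move=> g h [] /det; apply.
have /codomP[g [-> ->]] := inj_card_onto inj (eq_leq (etrans (card_prod Q Q) (esym cG))) (x, y).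
by exists g.
Qed.

(** The direct product construction of MacNeish. *)
Lemma oa_mul c m n : oa c m -> oa c n -> oa c (m * n).
Proof.
move=> [Q [G [ev [cQ [cG dG]]]]] [R [H [ew [cR [cH dH]]]]].
exists (Q * R)%type, (G * H)%type, (fun gh i => (ev gh.1 i, ew gh.2 i)).
rewrite !card_prod cQ cR; split=> //; split.
  by rewrite !card_prod cG cH cQ cR mulnACA.
move=> i j [g h] [g' h'] ij /= [e1 e2] [e3 e4].
by rewrite (dG i j g g') // (dH i j h h').
Qed.

Lemma oa1 c : oa c 1.
Proof.
exists unit, unit, (fun _ _ => tt); split; first by rewrite card_unit.
by split=> [|i j [] []]; rewrite ?card_unit.
Qed.

(** * Arrays and five-part decompositions from finite fields *)

Section Lines.
Variable F : finFieldType.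
Local Open Scope ring_scope.

Lemma line_eq (m c m' c' y z : F) : y != z ->
  m * y + c = m' * y + c' -> m * z + c = m' * z + c' -> (m, c) = (m', c').
Proof.
rewrite -subr_eq0 => yz e1 e2; have mm : m = m'.
  apply/(mulIf yz)/eqP; rewrite -subr_eq0.
  have : (m * y + c - (m * z + c)) - (m' * y + c' - (m' * z + c')) == 0.
    by rewrite e1 e2 subrr.
  by apply: etrans; congr (_ == _); ring.
by move: e1; rewrite mm => /addrI ->.
Qed.

(* The column of a field element [x] holds the values at [x] of the lines
   [m x + b]; the column [None] holds the slopes. *)
Lemma field_oa (c : nat) : (c <= #|F|.+1)%N -> oa c #|F|.
Proof.
move=> le; have le' : (c <= #|{: option F}|)%N by rewrite card_option.
pose x (i : 'I_c) : option F := enum_val (widen_ord le' i).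
have xI : injective x by move=> i j /enum_val_inj[] /val_inj.
pose ev (g : F * F) i := if x i is Some z then g.1 * z + g.2 else g.1.
exists F, (F * F)%type, ev; split=> //; split; first by rewrite card_prod.
move=> i j [m b] [m' b'] ij; have {ij} : x i != x j by rewrite (inj_eq xI).
rewrite /ev /=; case: (x i) (x j) => [y|] [z|] //= yz.
- by move=> e1 e2; apply: line_eq e1 e2; apply: contra yz => /eqP ->.
- by move=> + e; rewrite e => /addrI ->.
- by move=> -> /addrI ->.
Qed.

Variable F5 : (5 <= #|F|)%N.

Let x (i : 'I_5) : F := enum_val (widen_ord F5 i).

Let x_inj : injective x.
Proof. by move=> i j /enum_val_inj[] /val_inj. Qed.

Let p0 : 'I_5 := ord0.
Let p1 : 'I_5 := lift ord0 ord0.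

(* Forward blocks lie on the lines, backward blocks on parabolas; the line of
   [(m, c)] meets the parabola of [(m, c)] over the points [x p0] and [x p1], and
   any parabola in at most two points. *)
Let curve (k : (F * F) * bool) (p : 'I_5) : F :=
  k.1.1 * x p + k.1.2 + (if k.2 then (x p - x p0) * (x p - x p1) else 0).

(** Forward blocks visit the five parts in increasing order and cover the ordered pairs going up;
    backward blocks cover those going down. *)
Let place (k : (F * F) * bool) (p : 'I_5) : 'I_5 := if k.2 then rev_ord p else p.

Let line_through (y z u w : F) : y != z ->
  exists m c, m * y + c = u /\ m * z + c = w.
Proof.
rewrite -subr_eq0 => yz; exists ((u - w) / (y - z)), (u - (u - w) / (y - z) * y).
by split; [ring|field].
Qed.

Let curve_index k k' (i j : 'I_5) : i != j -> k.2 = k'.2 ->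
  curve k i = curve k' i -> curve k j = curve k' j -> k = k'.
Proof.
case: k k' => [[m c] e] [[m' c'] e'] /= ij <-; rewrite /curve /= => /addIr e1 /addIr e2.
by rewrite (line_eq _ e1 e2) // (inj_eq x_inj).
Qed.

(** The difference of a parabola and a line is a monic quadratic. Two of its roots have a fixed sum,
    by [quad], so a third root would equal the second. *)
Let parabola_line (k k' : (F * F) * bool) (i j l : 'I_5) : uniq [:: i; j; l] -> k.2 -> ~~ k'.2 ->
  curve k i = curve k' i -> curve k j = curve k' j -> curve k l = curve k' l -> False.
Proof.
case: k k' => [[m c] []] [[m' c'] []] //=; rewrite !inE negb_or andbT.
move=> /andP[/andP[ij il] jl] _ _; rewrite /curve /= !addr0.
have quad (y z : F) : y != z ->
    m * y + c + (y - x p0) * (y - x p1) = m' * y + c' ->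
    m * z + c + (z - x p0) * (z - x p1) = m' * z + c' ->
    y + z + (m - m') - x p0 - x p1 = 0.
  rewrite -subr_eq0 => yz e1 e2; apply/(mulIf yz); rewrite mul0r.
  have : (m * y + c + (y - x p0) * (y - x p1)) - (m * z + c + (z - x p0) * (z - x p1))
      = (m' * y + c') - (m' * z + c') by rewrite e1 e2.
  by move/eqP; rewrite -subr_eq0 => /eqP <-; ring.
move=> e1 e2 e3.
have h1 := quad _ _ _ e1 e2; have h2 := quad _ _ _ e1 e3.
have {h1 h2} : x j = x l.
  have : (x i + x j + (m - m') - x p0 - x p1) - (x i + x l + (m - m') - x p0 - x p1) = 0.
    by rewrite h1 ?h2 ?subrr // (inj_eq x_inj).
  by move=> h; apply/subr0_eq; rewrite -[RHS]h; ring.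
by move/x_inj/eqP; rewrite (negPf jl).
Qed.

Lemma good_multipartite_field : good (@multipartite 'I_5 F).
Proof.
have place_inj k : injective (place k).
  by rewrite /place; case: k.2 => // p q /rev_ord_inj.
exists ((F * F) * bool)%type, (fun k p => (place k p, curve k (place k p))),
  (fun k => (k.1, ~~ k.2)); split; first split.
- by move=> k p q pq; rewrite /multipartite /= (inj_eq (place_inj k)) neq_ltn pq.
- move=> [i u] [j w]; rewrite /multipartite /= => ij.
  have xij : x i != x j by rewrite (inj_eq x_inj).
  case: (ltngtP i j) (ij) => [lt|lt|/val_inj ->]; last by rewrite eqxx.
    have [m [c [e1 e2]]] := line_through u w xij.
    by exists ((m, c), false), i, j; rewrite /curve /place /= !addr0 e1 e2.
  have [m [c [e1 e2]]] := line_through (u - (x i - x p0) * (x i - x p1))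
                                     (w - (x j - x p0) * (x j - x p1)) xij.
  exists ((m, c), true), (rev_ord i), (rev_ord j).
  rewrite /place /= !rev_ordK /curve /= e1 e2 !subrK; split=> //.
  by have := ltn_ord i; lia.
- move=> k k' p q p' q' pq pq' [e1 e2] [e3 e4].
  (* The order in which a block visits two parts tells whether it is forward or backward. *)
  have kk : k.2 = k'.2.
    move: e1 e3; rewrite /place; case: k.2 k'.2 => [] [] // /(congr1 val) /= e1 /(congr1 val) /= e3;
      have := ltn_ord p; have := ltn_ord q; have := ltn_ord p'; have := ltn_ord q'; lia.
  move: e2 e4; rewrite -e1 -e3; apply: curve_index kk.
  by rewrite (inj_eq (place_inj k)) neq_ltn pq.
- move=> k k' p q r p' q' r' u [e1 e2] [e3 e4] [e5 e6].
  rewrite -e1 -e3 -e5 in e2 e4 e6.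
  have {}u : uniq [:: place k p; place k q; place k r].
    by rewrite -[X in uniq X]/(map (place k) [:: p; q; r]) map_inj_uniq.
  have pq : place k p != place k q by move: u; rewrite /= inE negb_or -andbA => /andP[].
  case: (eqVneq k.2 k'.2) => [kk|ne]; first exact: curve_index pq kk e2 e4.
  case: (boolP k.2) => h.
    by case: (parabola_line u h _ e2 e4 e6); move: ne; rewrite h; case: k'.2.
  by case: (parabola_line u _ h (esym e2) (esym e4) (esym e6)); move: ne; rewrite (negPf h); case: k'.2.
- by move=> [k b] [k' b'] [-> /negb_inj ->].
(* The added quadratic vanishes over [p0] and [p1]. These parts hold positions 0 and 1 of the
   forward block, and positions 4 and 3 of the backward one. *)
- have tr01 k : trade (fun p => (place (k, false) p, curve (k, false) (place (k, false) p)))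
                      (fun p => (place (k, true) p, curve (k, true) (place (k, true) p))).
    exists p0, p1, (rev_ord p1), (rev_ord p0); split=> //;
      by rewrite /place /= rev_ordK /curve /= subrr ?mul0r ?mulr0.
  move=> [k []]; last exact: tr01.
  by case: (tr01 k) => a [b [a' [b' [h1 h2 h3 h4]]]]; exists a', b', a, b.
Qed.

End Lines.

Lemma oa_prime_power c p k : prime p -> c <= (p ^ k).+1 -> oa c (p ^ k).
Proof.
move=> pp; case: k => [|k] le; first by rewrite expn0; apply: oa1.
have [F _ cF] := PrimePowerField pp (ltn0Sn k).
by rewrite -cF; apply: field_oa; rewrite cF.
Qed.

Lemma good_multipartite_prime_power p k : prime p -> 5 <= p ^ k ->
  good (@multipartite 'I_5 'I_(p ^ k)).
Proof.
move=> pp; case: k => [|k] le; first by rewrite expn0 in le.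
have [F _ cF] := PrimePowerField pp (ltn0Sn k).
rewrite -cF in le; apply: good_multipartite_card (good_multipartite_field le);
  by rewrite ?card_ord ?cF.
Qed.

(** * Inflation by orthogonal arrays *)

Lemma trade_positions (V I : finType) (b : I -> 'I_5 -> V) (t : I -> I) :
  (forall i, trade (b i) (b (t i))) ->
  exists p q p' q' : I -> 'I_5, forall i,
    [/\ q i = (p i).+1 :> nat, q' i = (p' i).+1 :> nat,
        b i (p i) = b (t i) (q' i) & b i (q i) = b (t i) (p' i)].
Proof.
by move=> /fin_all_exists[p] /fin_all_exists[q] /fin_all_exists[p'] /fin_all_exists[q'];
  exists p, q, p', q'.
Qed.

Lemma succ_neq (p q : 'I_5) : q = p.+1 :> nat -> p != q.
Proof. by move=> e; rewrite -val_eqE /= e neq_ltn leqnn. Qed.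

(** Each block is replaced by its liftings along the rows of the array. Three common points of two
    liftings project to three common points, so the base blocks agree, and then so do the rows,
    which share two entries. *)
Lemma good_inflate (V Q G : finType) (ev : G -> 'I_5 -> Q) (E : rel V) :
  sgraph E -> is_oa ev -> good E -> good (fun x y : V * Q => E x.1 y.1).
Proof.
move=> sE oaE [I [b [t [cov ss tI tr]]]]; have [_ det] := oaE.
have bI i : injective (b i) := @covers_inj _ _ b E i sE cov.
case: (cov) => sub ex un.
have [p [q [p' [q' P]]]] := trade_positions tr.
(* The lifted partner must carry the same symbols at the two traded points. Strength 2 supplies such
   a row; conversely these symbols determine [g], which makes the new partner map injective. *)
have /fin_all_exists[s sP] (ig : I * G) : exists g,
    ev g (q' ig.1) = ev ig.2 (p ig.1) /\ ev g (p' ig.1) = ev ig.2 (q ig.1).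
  by apply: oa_row => //; have [_ e _ _] := P ig.1; rewrite eq_sym succ_neq.
exists (I * G)%type, (fun ig c => (b ig.1 c, ev ig.2 c)), (fun ig => (t ig.1, s ig)).
split; first split.
- by move=> [i g] c d cd; apply: sub.
- move=> [x u] [y v] /= /ex[i [c [d [cd <- <-]]]].
  have [g [<- <-]] := oa_row u v oaE (i := c) (j := d) (negbT (ltn_eqF cd)).
  by exists (i, g), c, d.
- move=> [i g] [j h] c d c' d' cd cd' /= [e1 e2] [e3 e4].
  have ij := un i j c d c' d' cd cd' e1 e3; rewrite -ij in e1 e3 *.
  move/bI: e1 => cc; move/bI: e3 => dd; rewrite -cc -dd in e2 e4.
  by rewrite (det c d g h) // (negbT (ltn_eqF cd)).
- move=> [i g] [j h] c d r c' d' r' u /= [e1 e2] [e3 e4] [e5 e6].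
  have ij := ss i j c d r c' d' r' u e1 e3 e5; rewrite -ij in e1 e3 *.
  move/bI: e1 => cc; move/bI: e3 => dd; rewrite -cc -dd in e2 e4.
  have cd : c != d by move: u; rewrite /= inE negb_or -andbA => /andP[].
  by rewrite (det c d g h).
- move=> [i g] [j h] [] /tI ij; rewrite -{j}ij => es.
  have [/= e1 e2] := sP (i, g); have [/= e3 e4] := sP (i, h).
  have [e _ _ _] := P i; rewrite (det (p i) (q i) g h) ?succ_neq //.
    by rewrite -e1 es e3.
  by rewrite -e2 es e4.
- move=> [i g]; exists (p i), (q i), (p' i), (q' i); have [? ? e1 e2] := P i.
  by have [/= e3 e4] := sP (i, g); rewrite /= e1 e2 e3 e4.
Qed.

Lemma inflate_multipartite a m r : oa 5 r ->
  good (@multipartite 'I_a 'I_m) -> good (@multipartite 'I_a 'I_(m * r)).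
Proof.
move=> [Q [G [ev [cQ oaE]]]].
move=> /(good_inflate (@sgraph_multipartite _ _) oaE) gI.
have : good (@multipartite 'I_a ('I_m * Q)%type).
  apply: (good_bij (h := fun x : ('I_a * 'I_m) * Q => (x.1.1, (x.1.2, x.2)))) gI.
  - by split=> [x|x y]; rewrite /multipartite ?eqxx // eq_sym.
  - by exists (fun x => ((x.1, x.2.1), x.2.2)) => [[[]]|[? []]].
  - by [].
by apply: good_multipartite_card; rewrite ?card_prod !card_ord ?cQ.
Qed.

(** * Weighting a transversal design with one truncated group *)

Section Truncate.
Variables (Q R W : finType) (ev : R -> 'I_6 -> Q) (S : {set Q}).
Hypothesis oaE : is_oa ev.

Let N := {x : Q | x \in S}.
Let V := (('I_5 * (Q * W)) + (N * W))%type.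

Let col (x : V) : 'I_6 := if x is inl u then lift ord_max u.1 else ord_max.
Let entry (x : V) : Q := match x with inl u => u.2.1 | inr u => val u.1 end.
Let copy (x : V) : W := match x with inl u => u.2.2 | inr u => u.2 end.

Let point_eq x y : col x = col y -> entry x = entry y -> copy x = copy y -> x = y.
Proof.
case: x y => [[i [a w]]|[a w]] [[j [b w']]|[b w']] //=.
- by move=> /lift_inj -> -> ->.
- by move=> e; have := neq_lift ord_max i; rewrite e eqxx.
- by move=> e; have := neq_lift ord_max j; rewrite -e eqxx.
- by move=> _ /val_inj -> ->.
Qed.

(** Entries in two distinct columns determine one row of the array. The edges are sorted according
    to whether the last entry of this row survives the truncation. *)
Let edge (b : bool) : rel V := fun x y => (col x != col y) &&
  [exists r, [&& (ev r ord_max \in S) == b, ev r (col x) == entry x & ev r (col y) == entry y]].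

Let edgeP b x y : reflect (col x != col y /\ exists r,
    [/\ (ev r ord_max \in S) = b, ev r (col x) = entry x & ev r (col y) = entry y])
  (edge b x y).
Proof.
apply: (iffP andP) => -[xy].
  by move=> /existsP[r /and3P[/eqP h1 /eqP h2 /eqP h3]]; split=> //; exists r.
by move=> [r [/eqP h1 /eqP h2 /eqP h3]]; split=> //; apply/existsP; exists r; apply/and3P.
Qed.

Let sgraph_edge b : sgraph (edge b).
Proof.
split=> [x|x y]; first by rewrite /edge eqxx.
rewrite /edge eq_sym; congr (_ && _); apply: eq_existsb => r.
by rewrite [X in _ && X]andbC.
Qed.

Let K5 := {r : R | ev r ord_max \notin S}.
(** A surviving row is paired with its last entry as an element of [N], so that [h6] can return that
    point without a membership proof. *)
Let K6 := {k : R * N | ev k.1 ord_max == val k.2}.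

Let h5 (k : K5) (u : 'I_5 * W) : V := inl (u.1, (ev (val k) (lift ord_max u.1), u.2)).
Let h6 (k : K6) (u : 'I_6 * W) : V :=
  if unlift ord_max u.1 is Some i then inl (i, (ev (val k).1 u.1, u.2)) else inr ((val k).2, u.2).

Let h6E k u : [/\ col (h6 k u) = u.1, entry (h6 k u) = ev (val k).1 u.1 & copy (h6 k u) = u.2].
Proof.
rewrite /h6; case: unliftP => [i ->|->] //=; split=> //.
by rewrite (eqP (valP k)).
Qed.

Let good5 : good (@multipartite 'I_5 W) -> good (edge false).
Proof.
apply: (@good_images K5 _ _ _ _ h5).
- exact: sgraph_multipartite.
- by move=> k [i w] [j w'] [-> _ ->].
- move=> k k' [i w] [j w'] [i' u] [j' u'] ij _ [<- e1 _] [<- e2 _].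
  apply/val_inj; apply: (oaE.2) e1 e2.
  by rewrite (inj_eq lift_inj).
- move=> k [i w] [j w'] ij; apply/edgeP; split; first by rewrite /= (inj_eq lift_inj).
  by exists (val k); split=> //; apply: negbTE; exact: (valP k).
- move=> x y /edgeP[xy [r [/negbT rS ex ey]]].
  have inK z : ev r (col z) = entry z -> exists2 u, h5 (exist _ r rS) u = z & lift ord_max u.1 = col z.
    case: z => [[i [a w]]|[a w]] /= e; first by exists (i, w); rewrite // /h5 /= e.
    by case/negP: (rS); rewrite e; apply: (valP a).
  have [u ux cu] := inK x ex; have [u' uy cu'] := inK y ey.
  exists (exist _ r rS), u, u'; split=> //.
  by rewrite /multipartite -(inj_eq (@lift_inj _ ord_max)) cu cu'.
Qed.

Let good6 : good (@multipartite 'I_6 W) -> good (edge true).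
Proof.
apply: (@good_images K6 _ _ _ _ h6).
- exact: sgraph_multipartite.
- move=> k [i w] [j w'] e; have [/= c1 _ w1] := h6E k (i, w); have [/= c2 _ w2] := h6E k (j, w').
  by congr (_, _); [rewrite -[LHS]c1 e|rewrite -[LHS]w1 e].
- move=> k k' x y x' y' xy _ e1 e2.
  have [cx ex _] := h6E k x; have [cy ey _] := h6E k y.
  have [cx' ex' _] := h6E k' x'; have [cy' ey' _] := h6E k' y'.
  have kk : (val k).1 = (val k').1.
    apply: (oaE.2 x.1 y.1) => //; first by rewrite -ex e1 ex' -cx' -e1 cx.
    by rewrite -ey e2 ey' -cy' -e2 cy.
  apply/val_inj; case: k k' kk {e1 e2 cx ex cy ey cx' ex' cy' ey'} => [[r n] /= kP] [[r' n'] /= kP'] rr.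
  congr (_, _) => //; apply/val_inj/(etrans (esym (eqP kP)))/(etrans _ (eqP kP')).
  by rewrite /= rr.
- move=> k x y xy; apply/edgeP; have [cx ex _] := h6E k x; have [cy ey _] := h6E k y.
  rewrite cx cy; split=> //; exists (val k).1; rewrite ex ey; split=> //.
  by rewrite (eqP (valP k)) (valP (val k).2).
- move=> x y /edgeP[xy [r [rS ex ey]]].
  pose n : N := exist _ (ev r ord_max) rS.
  pose k : K6 := exist (fun k : R * N => ev k.1 ord_max == val k.2) (r, n) (eqxx _).
  have [cx' ex' wx] := h6E k (col x, copy x); have [cy' ey' wy] := h6E k (col y, copy y).
  exists k, (col x, copy x), (col y, copy y); split=> //; apply: point_eq => //.
    by rewrite ex'.
  by rewrite ey'.
Qed.

(** Wilson's fundamental construction: every point gets weight [#|W|], and rows that lose or keep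
    their last entry are replaced by decompositions with 5 or 6 parts. *)
Lemma good_truncate : good (@multipartite 'I_5 W) -> good (@multipartite 'I_6 W) ->
  good (@truncated 'I_5 (Q * W)%type (N * W)%type).
Proof.
move=> /good5 g5 /good6 g6.
apply: good_eq (good_union (sgraph_edge _) (sgraph_edge _) _ g5 g6).
- move=> x y; have -> : truncated x y = (col x != col y).
    case: x y => [[i a]|a] [[j b]|b] //=; rewrite ?(inj_eq lift_inj) ?eqxx //.
      by rewrite eq_sym neq_lift.
    by rewrite neq_lift.
  apply/idP/idP; first by case/orP=> /edgeP[].
  move=> xy; have [r [ex ey]] := oa_row (entry x) (entry y) oaE xy.
  case rS: (ev r ord_max \in S); apply/orP; [right|left]; apply/edgeP;
    by split=> //; exists r.
- move=> x y /edgeP[xy [r [rS ex ey]]]; apply/negP => /edgeP[_ [r' [rS' ex' ey']]].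
  have rr : r = r' by apply: (oaE.2 _ _ _ _ xy); rewrite ?ex ?ey.
  by move: rS; rewrite rr rS'.
Qed.

End Truncate.

Lemma truncate_multipartite u s w : oa 6 u -> s <= u ->
  good (@multipartite 'I_5 'I_w) -> good (@multipartite 'I_6 'I_w) ->
  good (@truncated 'I_5 'I_(u * w) 'I_(s * w)).
Proof.
move=> [Q [R [ev [cQ oaE]]]] su g5 g6.
pose S := [set x in take s (enum Q)].
have cS : #|S| = s.
  rewrite cardsE (card_uniqP _) ?take_uniq ?enum_uniq // size_take -cardE cQ.
  by case: ltngtP su.
apply: good_truncated_card (good_truncate S oaE g5 g6); rewrite !card_prod ?cQ !card_ord //.
by rewrite card_sig -cS; congr (_ * _); apply: eq_card => x; rewrite inE.
Qed.

(** * Executable checks for explicit base blocks *)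

(* Explicit designs are given by pairs of base blocks, the two blocks of a pair being
   a trade, to be developed by a cyclic group of order [q].  The points are binary
   numbers, for fast evaluation; the group rotates consecutive runs of [q] points and
   fixes the points from [l] on. *)
Definition block_pairs := seq (seq N * seq N).

Definition translate (q l s x : N) : N :=
  (if x <? l then x / q * q + (x mod q + s) mod q else x)%num.

Definition normalize (q l r x : N) : N := translate q l (q - r)%num x.

Definition ordered_pairs : seq (nat * nat) :=
  [:: (0, 1); (0, 2); (0, 3); (0, 4); (1, 2); (1, 3); (1, 4); (2, 3); (2, 4); (3, 4)].

Definition ordered_triples : seq (nat * nat * nat) :=
  [:: (0, 1, 2); (0, 1, 3); (0, 1, 4); (0, 2, 3); (0, 2, 4);
      (0, 3, 4); (1, 2, 3); (1, 2, 4); (1, 3, 4); (2, 3, 4)].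

(* Two pairs of points have the same code if and only if they differ by a translation. *)
Definition pair_code (v q l : N) (u : N * N) : N :=
  let r := ((if u.1 <? l then u.1 else u.2) mod q)%num in
  (normalize q l r u.1 * v + normalize q l r u.2)%num.

Definition covered (b : seq N) : seq (N * N) :=
  [seq (nth 0%num b u.1, nth 0%num b u.2) | u <- ordered_pairs].

(* A sum of weights is a symmetric function of the points; it determines them when
   the power sums do not overflow, but the proofs do not depend on this. *)
Definition weight (x : N) : N := (x + x * x * 1024 + x * x * x * 33554432)%num.

Definition triple_key (q l : N) (b : seq N) (u : nat * nat * nat) (r : N) : N :=
  let w i := weight (normalize q l r (nth 0%num b i)) in (w u.1.1 + w u.1.2 + w u.2)%num.

(* A triple has one key for each residue of its moved points, so that distinct keys
   also exclude triples that are preserved by a nontrivial translation. *)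
Definition anchored (q l : N) (b : seq N) : seq ((nat * nat * nat) * N) :=
  flatten [seq [seq (u, r) | r <- undup [seq (nth 0 b i mod q)%num
                                        | i <- [:: u.1.1; u.1.2; u.2] & (nth 0 b i <? l)%num]]
          | u <- ordered_triples].

Definition triple_keys (q l : N) (b : seq N) : seq N :=
  [seq triple_key q l b c.1 c.2 | c <- anchored q l b].

Definition trade_check (b c : seq N) : bool :=
  has (fun i => has (fun j =>
    (nth 0%num b i == nth 0%num c j.+1) && (nth 0%num b i.+1 == nth 0%num c j))
    [:: 0; 1; 2; 3]) [:: 0; 1; 2; 3].

Definition points (v : nat) : seq N := map N.of_nat (iota 0 v).

(* Only the edges whose first moved point has residue [0] are listed. *)
Definition edge_codes (v : nat) (q l : N) (E : rel N) : seq N :=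
  let V := points v in
  flatten [seq [seq (x * N.of_nat v + y)%num
               | y <- V & [|| x <? l, l <=? y | y mod q == 0]%num && E x y]
          | x <- V & (l <=? x)%num || (x mod q == 0)%num].

(** The sorted lists are compared as multisets. Since the edge codes are pairwise distinct, equality
    means that each orbit of ordered edges occurs at exactly one pair of positions of one base
    block. *)
Definition cover_check (v : nat) (q l : N) (E : rel N) (bs : block_pairs) : bool :=
  all (fun u => all (N.ltb^~ (N.of_nat v)) (u.1 ++ u.2) &&
                ((size u.1 == 5) && (size u.2 == 5))) bs &&
  (sort N.leb (flatten [seq map (pair_code (N.of_nat v) q l) (covered u.1 ++ covered u.2)
                       | u <- bs])
     == sort N.leb (edge_codes v q l E)).

(** Being sorted for the strict order after sorting expresses that the keys are distinct. *)
Definition triple_check (q l : N) (bs : block_pairs) : bool :=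
  sorted N.ltb (sort N.leb (flatten [seq triple_keys q l u.1 ++ triple_keys q l u.2 | u <- bs])).

Definition trades_check (bs : block_pairs) : bool := all (fun u => trade_check u.1 u.2) bs.

(** At most one point is left fixed, so among two points of a block at least one is moved and
    determines the translation. *)
Definition design_check (v q o : nat) (E : rel N) (bs : block_pairs) : bool :=
  let Q := N.of_nat q in let L := (N.of_nat o * Q)%num in
  [&& 0 < q, o * q <= v <= (o * q).+1, cover_check v Q L E bs, triple_check Q L bs
    & trades_check bs].

(** * Duplicate-free lists *)

Lemma uniq_flatten_nth (A : eqType) (ss : seq (seq A)) i j x :
  uniq (flatten ss) -> x \in nth [::] ss i -> x \in nth [::] ss j -> i = j.
Proof.
elim: ss i j => [|s ss IH] [|i] [|j] //=; rewrite cat_uniq => /and3P[_ /hasPn dis u].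
- move=> xs xj; have /dis : x \in flatten ss.
    apply/flattenP; exists (nth [::] ss j) => //; apply: mem_nth.
    by rewrite ltnNge; apply: contraL xj => /(nth_default [::]) ->.
  by rewrite /= xs.
- move=> xi xs; have /dis : x \in flatten ss.
    apply/flattenP; exists (nth [::] ss i) => //; apply: mem_nth.
    by rewrite ltnNge; apply: contraL xi => /(nth_default [::]) ->.
  by rewrite /= xs.
- by move=> xi xj; rewrite (IH i j).
Qed.

Lemma uniq_flatten_in (A : eqType) (ss : seq (seq A)) s :
  uniq (flatten ss) -> s \in ss -> uniq s.
Proof.
elim: ss => //= s' ss IH; rewrite cat_uniq => /and3P[us _ u].
by rewrite inE => /predU1P[->|/(IH u)].
Qed.

Lemma mem_if_eq (A : eqType) (s1 s2 : seq A) (a b : bool) x : uniq (s1 ++ s2) ->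
  x \in (if a then s2 else s1) -> x \in (if b then s2 else s1) -> a = b.
Proof.
rewrite cat_uniq => /and3P[_ /hasPn dis _].
by case: a b => [] [] // h1 h2; [case/negP: (dis _ h1)|case/negP: (dis _ h2)].
Qed.

Lemma uniq_map_inj (A B : eqType) (f : A -> B) s x y :
  uniq (map f s) -> x \in s -> y \in s -> f x = f y -> x = y.
Proof.
elim: s => //= z s IH /andP[zs us]; rewrite !inE => /predU1P[->|xs] /predU1P[->|ys] // e.
- by case/negP: zs; rewrite e map_f.
- by case/negP: zs; rewrite -e map_f.
- exact: IH.
Qed.

Lemma ordered_pairs_mem (p q : 'I_5) : p < q -> (nat_of_ord p, nat_of_ord q) \in ordered_pairs.
Proof. by case: p q => [[|[|[|[|[|p]]]]] hp] [[|[|[|[|[|q]]]]] hq]. Qed.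

Lemma ordered_triples_mem (p q r : 'I_5) : p < q -> q < r ->
  (nat_of_ord p, nat_of_ord q, nat_of_ord r) \in ordered_triples.
Proof.
by case: p q r => [[|[|[|[|[|p]]]]] hp] [[|[|[|[|[|q]]]]] hq] [[|[|[|[|[|r]]]]] hr].
Qed.

(** * Arithmetic of the cyclic translations *)

Section Translate.
Variables Q O : N.
Hypothesis Q0 : Q <> 0%num.
Let L := (O * Q)%num.
Let T := translate Q L.
Let norm := normalize Q L.

Lemma translate_fixed s x : (L <= x)%num -> T s x = x.
Proof. by move=> h; rewrite /T /translate; case: N.ltb_spec => //; lia. Qed.

Let divmod (x : N) : x = (x / Q * Q + x mod Q)%num.
Proof. by rewrite N.mul_comm; apply: N.Div0.div_mod. Qed.

Let div_lt x : (x < L)%num <-> (x / Q < O)%num.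
Proof.
have m := N.mod_lt x Q Q0; have d := divmod x; rewrite /L; split=> h.
  by apply: N.Div0.div_lt_upper_bound; lia.
suff : (x / Q * Q + Q <= O * Q)%num by lia.
by rewrite -N.mul_succ_l; apply: N.mul_le_mono_r; lia.
Qed.

Let translateE s x : (x < L)%num -> T s x = (x / Q * Q + (x mod Q + s) mod Q)%num.
Proof. by move=> h; rewrite /T /translate; case: N.ltb_spec => //; lia. Qed.

Let translate_div s x : (x < L)%num -> (T s x / Q = x / Q)%num.
Proof.
by move=> h; rewrite translateE // N.div_add_l // [(_ mod Q / Q)%num]N.div_small ?N.add_0_r //;
  apply: N.mod_lt.
Qed.

Lemma translate_mod s x : (x < L)%num -> (T s x mod Q = (x mod Q + s) mod Q)%num.
Proof. by move=> h; rewrite translateE // N.add_comm N.Div0.mod_add N.Div0.mod_mod. Qed.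

Lemma translate_lt s x : (T s x < L)%num <-> (x < L)%num.
Proof.
case: (N.ltb_spec x L) => h; last by rewrite translate_fixed.
by rewrite !div_lt translate_div // -div_lt.
Qed.

Lemma translate_translate s r x : T s (T r x) = T (r + s)%num x.
Proof.
case: (N.ltb_spec x L) => h; last by rewrite !translate_fixed.
rewrite translateE ?translate_lt // translate_div // translate_mod // translateE //.
by rewrite N.Div0.add_mod_idemp_l N.add_assoc.
Qed.

Lemma translate_cong s s' x : (s mod Q = s' mod Q)%num -> T s x = T s' x.
Proof.
move=> e; case: (N.ltb_spec x L) => h; last by rewrite !translate_fixed.
by rewrite !translateE // -(N.Div0.add_mod_idemp_r _ s) e N.Div0.add_mod_idemp_r.
Qed.

Lemma translate0 s x : (s mod Q = 0)%num -> T s x = x.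
Proof.
move=> e; rewrite (translate_cong (s' := 0)) ?N.Div0.mod_0_l //.
case: (N.ltb_spec x L) => h; last by rewrite translate_fixed.
by rewrite translateE // N.add_0_r N.Div0.mod_mod -divmod.
Qed.

Lemma add_mod_cancel a s s' :
  ((a + s) mod Q = (a + s') mod Q -> s mod Q = s' mod Q)%num.
Proof.
move=> e; have sub c : (c mod Q = (Q - a mod Q + (a + c) mod Q) mod Q)%num.
  rewrite N.Div0.add_mod_idemp_r -(N.Div0.mod_add c (a / Q + 1)).
  have := divmod a; have := N.mod_lt a Q Q0.
  by rewrite N.mul_add_distr_r => h1 h2; f_equal; lia.
by rewrite sub e -sub.
Qed.

Lemma translate_inj s : injective (T s).
Proof.
move=> x y /(congr1 (T (Q - s mod Q)%num)); rewrite !translate_translate.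
have d := divmod s; have m := N.mod_lt s Q Q0.
have e : (s + (Q - s mod Q) = (s / Q + 1) * Q)%num by lia.
by rewrite !translate0 // e N.Div0.mod_mul.
Qed.

Lemma translate_eq_mod s s' x x' : (x < L)%num -> (x' < L)%num ->
  (x mod Q = x' mod Q)%num -> T s x = T s' x' -> (s mod Q = s' mod Q)%num.
Proof.
move=> h h' e /(congr1 (N.modulo^~ Q)); rewrite !translate_mod // e.
exact: add_mod_cancel.
Qed.

Lemma normalize_inv r r' x x' : (r < Q)%num -> (r' < Q)%num ->
  norm r x = norm r' x' -> T (Q - r + r')%num x = x'.
Proof.
rewrite /norm /normalize -/T => hr hr' e.
rewrite -translate_translate e translate_translate translate0 //.
have -> : (Q - r' + r' = Q)%num by lia.
exact: N.Div0.mod_same.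
Qed.

Lemma normalize_translate r s x : (r < Q)%num ->
  norm ((r + s) mod Q)%num (T s x) = norm r x.
Proof.
move=> hr; rewrite /norm /normalize -/T translate_translate; apply: translate_cong.
have d := divmod (r + s)%num; have m := N.mod_lt (r + s) Q Q0.
have -> : (s + (Q - (r + s) mod Q) = (Q - r) + (r + s) / Q * Q)%num by lia.
exact: N.Div0.mod_add.
Qed.

Lemma normalize_mod x : (x < L)%num -> (norm (x mod Q) x mod Q = 0)%num.
Proof.
move=> h; rewrite translate_mod //; have m := N.mod_lt x Q Q0.
have -> : (x mod Q + (Q - x mod Q) = Q)%num by lia.
exact: N.Div0.mod_same.
Qed.

Lemma normalize0 x : norm 0 x = x.
Proof. by rewrite /norm /normalize -/T N.sub_0_r translate0 // N.Div0.mod_same. Qed.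

End Translate.

(** * Soundness of the checks *)

Section Check.
Variables (v m o : nat) (E : rel N) (bs : block_pairs).

Let V := N.of_nat v.+1.
Let Q := N.of_nat m.
Let L := (N.of_nat o * Q)%num.
Let T := translate Q L.

Hypothesis m_gt0 : 0 < m.
Hypothesis le_lv : o * m <= v.+1.
Hypothesis le_vl : v.+1 <= (o * m).+1.
Hypothesis E_irr : forall x, E x x = false.
Hypothesis E_tr : forall s x y, (x < V)%num -> (y < V)%num -> E (T s x) (T s y) = E x y.
Hypothesis cc : cover_check v.+1 Q L E bs.

Let Q0 : Q <> 0%num. Proof. by rewrite /Q; lia. Qed.

Let LE : L = N.of_nat (o * m).
Proof. by rewrite /L /Q; lia. Qed.

Let I := ('I_(size bs) * bool)%type.

Definition entries (i : I) : seq N :=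
  let u := nth ([::], [::]) bs i.1 in if i.2 then u.2 else u.1.

Let X i (p : 'I_5) := nth 0%num (entries i) p.

(** The default value of [inord] is never reached: translates of entries stay below [V], see
    [familyE]. *)
Definition family (gi : 'I_m * I) (p : 'I_5) : 'I_v.+1 :=
  inord (N.to_nat (T (N.of_nat gi.1) (X gi.2 p))).

Let bs_nth (i : 'I_(size bs)) : nth ([::], [::]) bs i \in bs.
Proof. exact: mem_nth. Qed.

Let X_lt i p : (X i p < V)%num.
Proof.
case/andP: cc => /allP H _; have /andP[/allP lt /andP[/eqP s1 /eqP s2]] := H _ (bs_nth i.1).
apply/N.ltb_lt/lt; rewrite mem_cat /X /entries; case: i.2; apply/orP; [right|left];
  by apply: mem_nth; rewrite ?s1 ?s2.
Qed.

Let T_lt s x : (x < V)%num -> (T s x < V)%num.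
Proof.
have lt_v y : (y < L)%num -> (y < V)%num by rewrite LE /V; lia.
move=> h; case: (N.ltb_spec x L) => hx; first exact/lt_v/translate_lt.
by rewrite /T translate_fixed.
Qed.

Let familyE gi p : N.of_nat (family gi p) = T (N.of_nat gi.1) (X gi.2 p).
Proof.
have h := T_lt (N.of_nat gi.1) (X_lt gi.2 p).
by rewrite /family inordK ?N2Nat.id //; move: h; rewrite /V; lia.
Qed.

Let of_nat_lt (x : 'I_v.+1) : (N.of_nat x < V)%num.
Proof. by have := ltn_ord x; rewrite /V; lia. Qed.

Let ord_N_inj (x y : 'I_v.+1) : N.of_nat x = N.of_nat y -> x = y.
Proof. by move=> /Nat2N.inj/val_inj. Qed.

Let code := pair_code V Q L.

Let anchor (u : N * N) : N := if (u.1 <? L)%num then u.1 else u.2.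

Let codeE u : code u = (normalize Q L (anchor u mod Q) u.1 * V + normalize Q L (anchor u mod Q) u.2)%num.
Proof. by []. Qed.

Let mulV_inj x y x' y' : (y < V)%num -> (y' < V)%num ->
  (x * V + y = x' * V + y')%num -> x = x' /\ y = y'.
Proof.
move=> hy hy' e; have V0 : V <> 0%num by rewrite /V; lia.
split.
  have := congr1 (N.div^~ V) e; rewrite /= !N.div_add_l // !N.div_small //; lia.
have := congr1 (N.modulo^~ V) e.
by rewrite /= ![(_ * V + _)%num]N.add_comm !N.Div0.mod_add !N.mod_small.
Qed.

Let mod_lt x : (x mod Q < Q)%num. Proof. exact: N.mod_lt. Qed.

Let code_orbit x y x' y' : (x < V)%num -> (y < V)%num -> (x' < V)%num -> (y' < V)%num ->
  code (x, y) = code (x', y') -> exists s, T s x = x' /\ T s y = y'.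
Proof.
move=> hx hy hx' hy'; rewrite !codeE => /mulV_inj[]; try exact: T_lt.
move=> /(normalize_inv Q0 (mod_lt _) (mod_lt _)) e1.
move=> /(normalize_inv Q0 (mod_lt _) (mod_lt _)) e2.
by eexists; split; [apply: e1|apply: e2].
Qed.

Let anchor_translate s u : anchor (T s u.1, T s u.2) = T s (anchor u).
Proof.
rewrite /anchor /=; have [h3 h4] := translate_lt (N.of_nat o) Q0 s u.1.
case: (N.ltb_spec u.1 L) => h1; case: N.ltb_spec => // h2.
  by have := h4 h1; rewrite -/L -/T; lia.
by have := h3 h2; lia.
Qed.

Let code_translate s u : code (T s u.1, T s u.2) = code u.
Proof.
rewrite !codeE anchor_translate /=; set a := anchor u.
case: (N.ltb_spec a L) => ha.
  by rewrite translate_mod // -!(normalize_translate (N.of_nat o) Q0 s _ (mod_lt a)).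
have fixed x : (x = u.1 \/ x = u.2) -> (L <= x)%num.
  by move: ha; rewrite /a /anchor; case: N.ltb_spec; [lia|move=> ? ? [] ->].
by rewrite /T !translate_fixed //; apply: fixed; [right|left].
Qed.

Let codes := flatten [seq map code (covered u.1 ++ covered u.2) | u <- bs].

Let pointsP x : reflect (x < V)%num (x \in points v.+1).
Proof.
apply: (iffP mapP) => [[n]|hx]; first by rewrite mem_iota /V => ? ->; lia.
by exists (N.to_nat x); rewrite ?N2Nat.id // mem_iota; move: hx; rewrite /V; lia.
Qed.

Let codes_perm : perm_eq codes (edge_codes v.+1 Q L E).
Proof. by case/andP: cc => _ /eqP e; rewrite -(perm_sort N.leb) e perm_sort. Qed.

(** A listed pair is already normalised, its first moved point having residue 0, so the number
    listed for it is its code. *)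
Let edge_codes_sub c : c \in edge_codes v.+1 Q L E ->
  exists x y, [/\ (x < V)%num, (y < V)%num, E x y & c = code (x, y)].
Proof.
case/flatten_mapP=> x; rewrite mem_filter => /andP[rx /pointsP hx] /mapP[y].
rewrite mem_filter => /andP[/andP[ry xy] /pointsP hy] ->; exists x, y; split=> //.
rewrite codeE /anchor /=; case: N.ltb_spec => h.
  have -> : (x mod Q = 0)%num by move: rx => /orP[/N.leb_le|/eqP //]; lia.
  by rewrite !normalize0.
case: (N.ltb_spec y L) => hy'.
  have -> : (y mod Q = 0)%num.
    by move: ry => /or3P[/N.ltb_lt|/N.leb_le|/eqP //]; lia.
  by rewrite !normalize0.
by rewrite /normalize !translate_fixed.
Qed.

Let code_edge x y : (x < V)%num -> (y < V)%num -> E x y -> code (x, y) \in edge_codes v.+1 Q L E.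
Proof.
move=> hx hy xy; rewrite codeE /=; set r := (anchor _ mod Q)%num.
apply/flatten_mapP; exists (normalize Q L r x).
  rewrite mem_filter; apply/andP; split; last exact/pointsP/T_lt.
  case: (N.leb_spec L (normalize Q L r x)) => //= /(translate_lt _ Q0) h.
  by apply/eqP; rewrite /r /anchor /=; case: N.ltb_spec => [_|]; [apply: normalize_mod|lia].
apply/mapP; exists (normalize Q L r y) => //.
rewrite mem_filter; apply/andP; split; last exact/pointsP/T_lt.
apply/andP; split; last by rewrite E_tr.
case: (N.ltb_spec (normalize Q L r x) L) => //= h.
case: (N.leb_spec L (normalize Q L r y)) => //= /(translate_lt _ Q0) h'.
have h2 : (L <= x)%num.
  case: (N.ltb_spec x L) => // hx'.
  by have := proj2 (translate_lt (N.of_nat o) Q0 (Q - r)%num x) hx'; move: h; rewrite /normalize -/L; lia.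
by apply/eqP; rewrite /r /anchor /=; case: N.ltb_spec => [|_]; [lia|apply: normalize_mod].
Qed.

Let codes_uniq : uniq codes.
Proof.
rewrite (perm_uniq codes_perm).
have uP : uniq (points v.+1) by rewrite map_inj_uniq ?iota_uniq //; apply: Nat2N.inj.
apply: allpairs_uniq_dep => [|x _|]; [exact: filter_uniq|exact: filter_uniq|].
move=> [x y] [x' y'] /allpairsPdep[a [b [_ hb [-> ->]]]] /allpairsPdep[a' [b' [_ hb' [-> ->]]]].
move: hb hb'; rewrite !mem_filter => /andP[_ /pointsP hb] /andP[_ /pointsP hb'] /=.
by case/mulV_inj => // -> ->.
Qed.

Let code_mem i (p q : 'I_5) : p < q -> code (X i p, X i q) \in map code (covered (entries i)).
Proof.
move=> pq; rewrite map_f //; apply/mapP.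
by exists (nat_of_ord p, nat_of_ord q); first exact: ordered_pairs_mem.
Qed.

Let nth_codes i c : c \in map code (covered (entries i)) ->
  c \in nth [::] [seq map code (covered u.1 ++ covered u.2) | u <- bs] i.1.
Proof.
rewrite (nth_map ([::], [::])) // /entries map_cat mem_cat.
by case: i.2 => ->; rewrite ?orbT.
Qed.

Let code_index i j c : c \in map code (covered (entries i)) ->
  c \in map code (covered (entries j)) -> i = j.
Proof.
move=> ci cj; have ij : i.1 = j.1.
  by apply/val_inj/(uniq_flatten_nth codes_uniq (nth_codes ci) (nth_codes cj)).
have : uniq (map code (covered (nth ([::], [::]) bs i.1).1 ++ covered (nth ([::], [::]) bs i.1).2)).
  by apply: (uniq_flatten_in codes_uniq); apply/map_f/bs_nth.
rewrite map_cat; case: i j ij ci cj => [i a] [j a'] ij.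
have {}ij : i = j := ij; rewrite -ij /entries /fst /snd !(fun_if covered) !(fun_if (map _)) => ci cj u.
by rewrite (mem_if_eq u ci cj).
Qed.

Let code_position i (p q p' q' : 'I_5) : p < q -> p' < q' ->
  code (X i p, X i q) = code (X i p', X i q') -> p = p' /\ q = q'.
Proof.
move=> pq pq' e; have u : uniq (map code (covered (entries i))).
  have : uniq (map code (covered (nth ([::], [::]) bs i.1).1 ++ covered (nth ([::], [::]) bs i.1).2)).
    by apply: (uniq_flatten_in codes_uniq); apply/map_f/bs_nth.
  by rewrite map_cat cat_uniq /entries => /and3P[u1 _ u2]; case: i.2.
rewrite -map_comp in u.
have [] := uniq_map_inj u (ordered_pairs_mem pq) (ordered_pairs_mem pq') e.
by move=> /val_inj -> /val_inj ->.
Qed.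

Let X_edge i (p q : 'I_5) : p < q -> E (X i p) (X i q).
Proof.
move=> pq; have : code (X i p, X i q) \in edge_codes v.+1 Q L E.
  rewrite -(perm_mem codes_perm); apply/flattenP; exists
    (nth [::] [seq map code (covered u.1 ++ covered u.2) | u <- bs] i.1).
    by apply: mem_nth; rewrite size_map.
  exact/nth_codes/code_mem.
case/edge_codes_sub=> x [y [hx hy xy /code_orbit[] // s [e1 e2]]].
by rewrite -(E_tr s) // e1 e2.
Qed.

Let X_inj i : injective (X i).
Proof.
move=> p q e; apply/eqP/negPn/negP => /ord_neq_lt/orP[] /(X_edge i);
  by rewrite e E_irr.
Qed.

Let some_moved i (p q : 'I_5) : p != q -> (X i p < L)%num \/ (X i q < L)%num.
Proof.
move=> pq; have ne : X i p <> X i q by move/X_inj/eqP; rewrite (negPf pq).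
have := X_lt i p; have := X_lt i q; rewrite LE /V; lia.
Qed.

Let shift_eq (g g' : 'I_m) : (N.of_nat g mod Q = N.of_nat g' mod Q)%num -> g = g'.
Proof.
by rewrite !N.mod_small; [move/Nat2N.inj/val_inj|have := ltn_ord g'; rewrite /Q; lia|
  have := ltn_ord g; rewrite /Q; lia].
Qed.

Lemma family_covers : covers family (fun x y : 'I_v.+1 => E (N.of_nat x) (N.of_nat y)).
Proof.
split.
- by move=> gi p q' pq; rewrite !familyE E_tr //; apply: X_edge.
- move=> x y xy; have : code (N.of_nat x, N.of_nat y) \in codes.
    by rewrite (perm_mem codes_perm); apply: code_edge.
  case/flatten_mapP=> u /(nthP ([::], [::]))[k hk uE] /mapP[c cu ec].
  have [i cE] : exists i : I, c \in covered (entries i).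
    move: cu; rewrite mem_cat => /orP[cu|cu].
      by exists (Ordinal hk, false); rewrite /entries /= uE.
    by exists (Ordinal hk, true); rewrite /entries /= uE.
  case/mapP: cE => -[p q'] pq cE.
  have {pq} [hp hq pq] : [/\ p < 5, q' < 5 & p < q'].
    by move: pq; do 9?[rewrite inE => /predU1P[[-> ->] //|]]; rewrite inE => /eqP[-> ->].
  have [s [e1 e2]] : exists s, T s (X i (Ordinal hp)) = N.of_nat x /\
                               T s (X i (Ordinal hq)) = N.of_nat y.
    by apply: code_orbit => //; rewrite ec cE.
  have hs : N.to_nat (s mod Q) < m by have := mod_lt s; rewrite /Q; lia.
  have sE z : T (N.of_nat (Ordinal hs)) z = T s z.
    by apply: translate_cong => //; rewrite /= N2Nat.id N.Div0.mod_mod.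
  exists (Ordinal hs, i), (Ordinal hp), (Ordinal hq); split=> //; apply: ord_N_inj;
    by rewrite familyE sE.
- move=> [g i] [g' j] p q1 p' q1' pq pq' /(congr1 (fun x : 'I_v.+1 => N.of_nat x)) e1.
  move=> /(congr1 (fun x : 'I_v.+1 => N.of_nat x)) e2.
  rewrite !familyE /= in e1 e2.
  have e : code (X i p, X i q1) = code (X j p', X j q1').
    by rewrite -(code_translate (N.of_nat g)) /= e1 e2 (code_translate _ (_, _)).
  have ij : i = j.
    by apply: (code_index (code_mem i pq)); rewrite e; apply: code_mem.
  rewrite -ij in e e1 e2 *; have [ep eq] := code_position pq pq' e.
  (* Block and positions being identified by the code, the translation is read off a moved point. *)
  rewrite -ep -eq in e1 e2; congr (_, _); apply: shift_eq.
  have [h|h] := some_moved i (negbT (ltn_eqF pq)).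
    exact: translate_eq_mod e1.
  exact: translate_eq_mod e2.
Qed.

Let anchored_mem (b : seq N) (u : nat * nat * nat) i : u \in ordered_triples ->
  i \in [:: u.1.1; u.1.2; u.2] -> (nth 0%num b i < L)%num ->
  (u, nth 0 b i mod Q)%num \in anchored Q L b.
Proof.
move=> hu hi hb; apply/flatten_mapP; exists u => //; apply/mapP.
exists (nth 0 b i mod Q)%num => //; rewrite mem_undup; apply/mapP; exists i => //.
by rewrite mem_filter hi andbT; apply/N.ltb_lt.
Qed.

(** Keys are listed for increasing positions only; a sum of weights is symmetric, so the positions
    may be sorted first. *)
Let triple_index (b : seq N) (p q r a : 'I_5) : uniq [:: p; q; r] -> a \in [:: p; q; r] ->
  (nth 0%num b a < L)%num ->
  let w (x : 'I_5) := weight (normalize Q L (nth 0 b a mod Q) (nth 0 b x))%num in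
  exists2 c, c \in anchored Q L b &
    (c.2 = nth 0 b a mod Q)%num /\ triple_key Q L b c.1 c.2 = (w p + w q + w r)%num.
Proof.
move=> u ha hb w.
have key (x y z : 'I_5) : x < y -> y < z -> a \in [:: x; y; z] ->
    (w x + w y + w z = w p + w q + w r)%num ->
    exists2 c, c \in anchored Q L b &
    (c.2 = nth 0 b a mod Q)%num /\ triple_key Q L b c.1 c.2 = (w p + w q + w r)%num.
  move=> xy yz ai <-; exists ((nat_of_ord x, nat_of_ord y, nat_of_ord z), (nth 0 b a mod Q)%num) => //.
  apply: anchored_mem hb; first exact: ordered_triples_mem.
  exact: (map_f (@nat_of_ord 5) ai).
have {u} [npq npr nqr] : [/\ p != q :> nat, p != r :> nat & q != r :> nat].
  by move: u; rewrite /= !inE negb_or andbT => /andP[/andP[-> ->] ->].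
move: ha; rewrite !inE => ha.
case: (ltngtP p q) npq => // pq _; case: (ltngtP p r) npr => // pr _;
  case: (ltngtP q r) nqr => // qr _.
- by apply: (key p q r); rewrite // !inE.
- by apply: (key p r q); rewrite ?inE //; [case/or3P: ha => ->; rewrite ?orbT|lia].
- by lia.
- by apply: (key r p q); rewrite ?inE //; [case/or3P: ha => ->; rewrite ?orbT|lia].
- by apply: (key q p r); rewrite ?inE //; [case/or3P: ha => ->; rewrite ?orbT|lia].
- by lia.
- by apply: (key q r p); rewrite ?inE //; [case/or3P: ha => ->; rewrite ?orbT|lia].
- by apply: (key r q p); rewrite ?inE //; [case/or3P: ha => ->; rewrite ?orbT|lia].
Qed.

Hypothesis tc : triple_check Q L bs.

Let keys_uniq : uniq (flatten [seq triple_keys Q L u.1 ++ triple_keys Q L u.2 | u <- bs]).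
Proof.
rewrite -(sort_uniq N.leb); apply: sorted_uniq tc => [x y z|x].
  by move=> /N.ltb_lt h1 /N.ltb_lt h2; apply/N.ltb_lt; lia.
by rewrite N.ltb_irrefl.
Qed.

Let key_index i j k : k \in triple_keys Q L (entries i) -> k \in triple_keys Q L (entries j) -> i = j.
Proof.
have nthk l : k \in triple_keys Q L (entries l) ->
    k \in nth [::] [seq triple_keys Q L u.1 ++ triple_keys Q L u.2 | u <- bs] l.1.
  by rewrite (nth_map ([::], [::])) // /entries mem_cat; case: l.2 => ->; rewrite ?orbT.
move=> ki kj; have ij : i.1 = j.1.
  by apply/val_inj/(uniq_flatten_nth keys_uniq (nthk i ki) (nthk j kj)).
have := uniq_flatten_in keys_uniq (map_f _ (mem_nth ([::], [::]) (ltn_ord i.1))).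
case: i j ij ki kj {nthk} => [i a] [j b] ij.
have {}ij : i = j := ij; rewrite -ij /entries /fst /snd !(fun_if (triple_keys Q L)) => ki kj u'.
by rewrite (mem_if_eq u' ki kj).
Qed.

Let keys_block_uniq i : uniq (triple_keys Q L (entries i)).
Proof.
have := uniq_flatten_in keys_uniq (map_f _ (mem_nth ([::], [::]) (ltn_ord i.1))).
by rewrite cat_uniq /entries => /and3P[u1 _ u2]; case: i.2.
Qed.

(** Take a moved point among the three common ones and normalise both blocks by it: the two base
    triples get the same key, so base blocks and anchored triples coincide. *)
Lemma family_super_simple : super_simple_family family.
Proof.
move=> [g i] [g' j] p q r p' q' r' u.
move=> /(congr1 (fun x : 'I_v.+1 => N.of_nat x)) e1 /(congr1 (fun x : 'I_v.+1 => N.of_nat x)) e2.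
move=> /(congr1 (fun x : 'I_v.+1 => N.of_nat x)) e3; rewrite !familyE /= in e1 e2 e3.
have T_ne x y x' y' : x != y -> T (N.of_nat g) (X i x) = T (N.of_nat g') (X j x') ->
    T (N.of_nat g) (X i y) = T (N.of_nat g') (X j y') -> x' != y'.
  move=> xy h1 h2; apply: contra_neq xy => exy; apply: (@X_inj i).
  have {}h2 : T (N.of_nat g) (X i x) = T (N.of_nat g) (X i y) by rewrite h1 h2 exy.
  exact: translate_inj h2.
have [pq pr qr] : [/\ p != q, p != r & q != r].
  by move: u; rewrite /= !inE negb_or andbT => /andP[/andP[-> ->] ->].
have u' : uniq [:: p'; q'; r'].
  by rewrite /= !inE negb_or (T_ne p q p' q') // (T_ne p r p' r') // (T_ne q r q' r').
have moved a a' : a \in [:: p; q; r] -> a' \in [:: p'; q'; r'] -> (X i a < L)%num ->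
    T (N.of_nat g) (X i a) = T (N.of_nat g') (X j a') -> (g, i) = (g', j).
  move=> ha ha' hX e; set gN := N.of_nat g in e e1 e2 e3; set gN' := N.of_nat g' in e e1 e2 e3.
  have hX' : (X j a' < L)%num.
    by apply/(translate_lt _ Q0 gN'); rewrite -/T -e; apply/translate_lt.
  have [c ci [rc kc]] := triple_index u ha hX.
  have [c' ci' [rc' kc']] := triple_index u' ha' hX'.
  have norm x x' : T gN (X i x) = T gN' (X j x') ->
      normalize Q L (X i a mod Q)%num (X i x) = normalize Q L (X j a' mod Q)%num (X j x').
    move=> h; rewrite -(normalize_translate (N.of_nat o) Q0 gN _ (mod_lt _)) -/L -/T h.
    rewrite -(normalize_translate (N.of_nat o) Q0 gN' (X j x') (mod_lt _)) -/L -/T.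
    by congr (normalize _ _ _ _); rewrite -(translate_mod Q0 gN hX) -(translate_mod Q0 gN' hX') -/T e.
  have k : triple_key Q L (entries i) c.1 c.2 = triple_key Q L (entries j) c'.1 c'.2.
    by rewrite kc kc' -/(X i p) -/(X i q) -/(X i r) -/(X i a) !(norm _ _ e1, norm _ _ e2, norm _ _ e3).
  have ij : i = j.
    by apply: key_index; [apply: map_f ci|rewrite k; apply: map_f ci'].
  have cc' : c = c'.
    by move: k ci'; rewrite -ij => k ci'; apply: uniq_map_inj (keys_block_uniq i) ci ci' k.
  have rr : (X i a mod Q = X j a' mod Q)%num by rewrite /X -rc -rc' cc'.
  (* The anchors have equal residues and equal translates, so the two translations agree. *)
  by rewrite -ij; congr (_, _); apply: shift_eq; apply: translate_eq_mod rr e.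
have [h|h] := some_moved i pq.
  by apply: (moved p p'); rewrite // inE eqxx.
by apply: (moved q q'); rewrite // !inE eqxx ?orbT.
Qed.

Hypothesis tr : trades_check bs.

Lemma family_trade gi : trade (family gi) (family (gi.1, (gi.2.1, ~~ gi.2.2))).
Proof.
case: gi => [g [i c]] /=.
have /(allP tr) /hasP[p hp /hasP[p' hp' /andP[/eqP e1 /eqP e2]]] := bs_nth i.
have lt k : k \in [:: 0; 1; 2; 3] -> k < 4 by move: k; apply/allP.
have hp5 : p < 5 by apply: ltnW (lt _ hp).
have hq5 : p.+1 < 5 by apply: (lt _ hp).
have hp5' : p' < 5 by apply: ltnW (lt _ hp').
have hq5' : p'.+1 < 5 by apply: (lt _ hp').
have tr01 : trade (family (g, (i, false))) (family (g, (i, true))).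
  exists (Ordinal hp5), (Ordinal hq5), (Ordinal hp5'), (Ordinal hq5').
  by rewrite /family /X /entries /= e1 e2.
case: c => //=; case: tr01 => a [b [a' [b' [h1 h2 h3 h4]]]].
by exists a', b', a, b.
Qed.

Lemma family_good : good (fun x y : 'I_v.+1 => E (N.of_nat x) (N.of_nat y)).
Proof.
exists ('I_m * I)%type, family, (fun gi => (gi.1, (gi.2.1, ~~ gi.2.2))); split.
- exact: family_covers.
- exact: family_super_simple.
- by move=> [g [i c]] [g' [i' c']] [-> -> /negb_inj ->].
- exact: family_trade.
Qed.

End Check.

Lemma design_check_good v q o (E : rel N) bs : (forall x, E x x = false) ->
  (forall s x y, (x < N.of_nat v.+1)%num -> (y < N.of_nat v.+1)%num ->
     E (translate (N.of_nat q) (N.of_nat o * N.of_nat q) s x)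
       (translate (N.of_nat q) (N.of_nat o * N.of_nat q) s y) = E x y) ->
  design_check v.+1 q o E bs -> good (fun x y : 'I_v.+1 => E (N.of_nat x) (N.of_nat y)).
Proof.
move=> Ei Et /and5P[q0 /andP[h1 h2] cc tc tr].
exact: (family_good q0 h1 h2 Ei Et cc tc tr).
Qed.

(** * From graphs on numbers to the abstract graphs *)

Section Transfer.
Variables (v q o : nat) (bs : block_pairs).

Let T := translate (N.of_nat q) (N.of_nat o * N.of_nat q)%num.

Let q_neq0 E : design_check v.+1 q o E bs -> N.of_nat q <> 0%num.
Proof. by case/andP=> q0 _; lia. Qed.

Let of_nat_eq (x y : nat) : (N.of_nat x == N.of_nat y) = (x == y).
Proof. exact: (inj_eq Nat2N.inj). Qed.

Let of_nat_mod (x g : nat) : 0 < g -> (N.of_nat x mod N.of_nat g)%num = N.of_nat (x %% g).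
Proof.
move=> g0; apply/esym/(N.mod_unique _ _ (N.of_nat (x %/ g))).
  by have := ltn_pmod x g0; lia.
by have := divn_eq x g; lia.
Qed.

Lemma complete_of_check :
  design_check v.+1 q o (fun x y => x != y) bs -> good (@complete 'I_v.+1).
Proof.
move=> ok; have q0 := q_neq0 ok.
apply: good_eq (design_check_good _ _ ok) => [x y|x|s x y _ _].
- by rewrite /complete of_nat_eq.
- by rewrite eqxx.
- by rewrite (inj_eq (translate_inj q0 (s := s))).
Qed.

(** The residue of a point modulo [g] is its part, the quotient its place in the part. *)
Let multipartite_of_check g m : v.+1 = g * m ->
  (forall s x y, (x < N.of_nat v.+1)%num -> (y < N.of_nat v.+1)%num ->
     ((T s x mod N.of_nat g)%num == (T s y mod N.of_nat g)%num) =
     ((x mod N.of_nat g)%num == (y mod N.of_nat g)%num)) ->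
  design_check v.+1 q o (fun x y => x mod N.of_nat g != y mod N.of_nat g)%num bs ->
  good (@multipartite 'I_g 'I_m).
Proof.
move=> e Et ok; have g0 : 0 < g by case: (posnP g) e => // ->.
have qm (x : 'I_v.+1) : x %/ g < m by rewrite ltn_divLR // mulnC -e.
have hI : injective (fun x : 'I_v.+1 => (Ordinal (ltn_pmod x g0), Ordinal (qm x))).
  by move=> x y [e1 e2]; apply/val_inj; rewrite /= (divn_eq x g) e1 e2 -divn_eq.
have hB := inj_card_bij hI (eq_leq (etrans (card_prod _ _)
  (etrans (congr2 muln (card_ord g) (card_ord m)) (etrans (esym e) (esym (card_ord v.+1)))))).
pose E (x y : 'I_v.+1) := x %% g != y %% g.
apply: (good_bij (E := E) _ hB) => [|x y|].
- by split=> [x|x y]; rewrite /E ?eqxx // eq_sym.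
- by [].
apply: good_eq (design_check_good _ _ ok) => [x y|x|s x y hx hy].
- by rewrite /E !of_nat_mod // of_nat_eq.
- by rewrite eqxx.
- by rewrite Et.
Qed.

(** As [g] divides [q], rotation by [s] adds [s] to every residue modulo [g], and so permutes the
    parts. *)
Lemma multipartite_of_cyclic_check g m : v.+1 = g * m -> v.+1 = o * q -> g %| q ->
  design_check v.+1 q o (fun x y => x mod N.of_nat g != y mod N.of_nat g)%num bs ->
  good (@multipartite 'I_g 'I_m).
Proof.
move=> e e' /dvdnP[c qE] ok; have q0 := q_neq0 ok.
have g0 : N.of_nat g <> 0%num by case: (posnP g) e => [->|]; lia.
have mod_g y : ((y mod N.of_nat q) mod N.of_nat g = y mod N.of_nat g)%num.
  have d := N.Div0.div_mod y (N.of_nat q).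
  rewrite {2}d -(N.Div0.mod_add (y mod N.of_nat q) (N.of_nat c * (y / N.of_nat q))).
  by congr (_ mod _)%num; rewrite qE; lia.
apply: multipartite_of_check e _ ok => s x y hx hy.
have L z : (z < N.of_nat v.+1)%num -> (T s z mod N.of_nat g = (z + s) mod N.of_nat g)%num.
  move=> hz; have hL : (z < N.of_nat o * N.of_nat q)%num by lia.
  by rewrite -mod_g translate_mod // N.Div0.add_mod_idemp_l mod_g.
rewrite !L // ![(_ + s)%num]N.add_comm; apply/eqP/eqP => [|e2]; first exact: add_mod_cancel.
by rewrite -(N.Div0.add_mod_idemp_r s x) e2 N.Div0.add_mod_idemp_r.
Qed.

(** With [q = 1] all translations are trivial and the list contains every block. *)
Lemma multipartite_of_plain_check g m : v.+1 = g * m -> q = 1 ->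
  design_check v.+1 q o (fun x y => x mod N.of_nat g != y mod N.of_nat g)%num bs ->
  good (@multipartite 'I_g 'I_m).
Proof.
move=> e q1 ok; apply: multipartite_of_check e _ ok => s x y _ _.
by rewrite /T q1 !translate0 ?N.mod_1_r.
Qed.

Lemma hole_of_plain_check m k : v.+1 = m + k -> q = 1 ->
  design_check v.+1 q o (fun x y => (x != y) && ((x <? N.of_nat m) || (y <? N.of_nat m)))%num bs ->
  good (@hole 'I_m 'I_k).
Proof.
move=> e q1 ok; pose E (x y : 'I_(m + k)) := (x != y) && ((x < m) || (y < m)).
have gE : good E.
  rewrite /E -e; apply: good_eq (design_check_good _ _ ok) => [x y|x|s x y _ _].
  - have lt z : (N.of_nat z <? N.of_nat m)%num = (z < m) by case: N.ltb_spec; lia.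
    by rewrite of_nat_eq !lt.
  - by rewrite eqxx.
  - by rewrite q1 !translate0 ?N.mod_1_r.
apply: (good_bij (E := E) (h := @split m k) _ _ _ gE).
- split=> [x|x y]; rewrite /E ?eqxx // eq_sym; congr (_ && _); exact: orbC.
- by exists (@unsplit m k); [apply: splitK|apply: unsplitK].
- move=> x y; rewrite /hole (inj_eq (can_inj (@splitK m k))) /E; congr (_ && _).
  by case: (split_ordP x) => a _; case: (split_ordP y) => b _.
Qed.

End Transfer.

(** * The explicit ingredients *)

Definition base_multipartite_5_4 : block_pairs :=
  [:: ([:: 0; 11; 12; 18; 9], [:: 4; 18; 12; 1; 5]);
    ([:: 0; 16; 17; 8; 14], [:: 19; 8; 17; 6; 5]); ([:: 10; 6; 17; 3; 9], [:: 9; 3; 2; 11; 5]);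
    ([:: 10; 1; 12; 13; 14], [:: 14; 13; 7; 16; 5]);
    ([:: 15; 16; 2; 13; 9], [:: 9; 13; 17; 1; 0]);
    ([:: 15; 11; 7; 3; 14], [:: 14; 3; 12; 6; 0]); ([:: 15; 6; 12; 8; 4], [:: 4; 8; 7; 11; 0]);
    ([:: 15; 1; 17; 18; 19], [:: 19; 18; 2; 16; 0]);
    ([:: 10; 11; 2; 8; 19], [:: 14; 8; 2; 1; 15]);
    ([:: 10; 16; 7; 18; 4], [:: 9; 18; 7; 6; 15]);
    ([:: 0; 6; 7; 13; 19], [:: 19; 13; 12; 11; 15]);
    ([:: 0; 1; 2; 3; 4], [:: 4; 3; 17; 16; 15]); ([:: 5; 16; 12; 3; 19], [:: 19; 3; 7; 1; 10]);
    ([:: 5; 11; 17; 13; 4], [:: 4; 13; 2; 6; 10]);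
    ([:: 5; 6; 2; 18; 14], [:: 14; 18; 17; 11; 10]); ([:: 5; 1; 7; 8; 9], [:: 9; 8; 12; 16; 10])]%num.

Lemma good_multipartite_5_4 : good (@multipartite 'I_5 'I_4).
Proof. by apply: (@multipartite_of_plain_check 19 1 20 base_multipartite_5_4); vm_compute. Qed.

Definition base_multipartite_6_4 : block_pairs :=
  [:: ([:: 5; 1; 3; 0; 16], [:: 22; 1; 5; 6; 15])]%num.

Lemma good_multipartite_6_4 : good (@multipartite 'I_6 'I_4).
Proof. by apply: (@multipartite_of_cyclic_check 23 24 1 base_multipartite_6_4); vm_compute. Qed.

Definition base_multipartite_6_8 : block_pairs :=
  [:: ([:: 13; 4; 0; 17; 38], [:: 18; 15; 10; 38; 17]);
    ([:: 2; 16; 0; 31; 5], [:: 7; 15; 0; 16; 26])]%num.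

Lemma good_multipartite_6_8 : good (@multipartite 'I_6 'I_8).
Proof. by apply: (@multipartite_of_cyclic_check 47 48 1 base_multipartite_6_8); vm_compute. Qed.

Definition base_multipartite_6_24 : block_pairs :=
  [:: ([:: 124; 80; 111; 0; 5], [:: 101; 14; 4; 0; 111]);
    ([:: 15; 64; 92; 0; 85], [:: 0; 92; 106; 37; 35]);
    ([:: 68; 0; 15; 94; 133], [:: 45; 0; 68; 46; 17]);
    ([:: 49; 8; 3; 0; 112], [:: 5; 66; 4; 8; 49]);
    ([:: 136; 0; 51; 32; 113], [:: 32; 51; 106; 85; 12]);
    ([:: 88; 0; 27; 11; 2], [:: 115; 122; 131; 0; 88])]%num.

Lemma good_multipartite_6_24 : good (@multipartite 'I_6 'I_24).
Proof. by apply: (@multipartite_of_cyclic_check 143 144 1 base_multipartite_6_24); vm_compute. Qed.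

Definition base_multipartite_7_10 : block_pairs :=
  [:: ([:: 61; 38; 8; 0; 27], [:: 45; 5; 58; 0; 8]);
    ([:: 0; 5; 2; 43; 39], [:: 65; 21; 39; 43; 19]);
    ([:: 60; 19; 13; 1; 0], [:: 0; 1; 55; 16; 61])]%num.

Lemma good_multipartite_7_10 : good (@multipartite 'I_7 'I_10).
Proof. by apply: (@multipartite_of_cyclic_check 69 70 1 base_multipartite_7_10); vm_compute. Qed.

Definition base_multipartite_7_20 : block_pairs :=
  [:: ([:: 80; 2; 34; 0; 11], [:: 122; 11; 0; 54; 100]);
    ([:: 20; 54; 71; 102; 0], [:: 79; 115; 99; 0; 102]);
    ([:: 0; 2; 75; 99; 39], [:: 127; 83; 75; 2; 133]);
    ([:: 39; 0; 79; 22; 55], [:: 3; 55; 22; 67; 133]);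
    ([:: 31; 5; 0; 13; 1], [:: 55; 0; 5; 108; 81]);
    ([:: 48; 1; 45; 75; 0], [:: 73; 54; 1; 48; 58])]%num.

Lemma good_multipartite_7_20 : good (@multipartite 'I_7 'I_20).
Proof. by apply: (@multipartite_of_cyclic_check 139 140 1 base_multipartite_7_20); vm_compute. Qed.

Definition base_multipartite_9_5 : block_pairs :=
  [:: ([:: 2; 10; 23; 7; 0], [:: 21; 16; 4; 23; 10]);
    ([:: 42; 20; 0; 1; 12], [:: 4; 21; 35; 0; 20])]%num.

Lemma good_multipartite_9_5 : good (@multipartite 'I_9 'I_5).
Proof. by apply: (@multipartite_of_cyclic_check 44 45 1 base_multipartite_9_5); vm_compute. Qed.

Definition base_multipartite_11_4 : block_pairs :=
  [:: ([:: 23; 7; 37; 0; 3], [:: 24; 25; 42; 7; 23]);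
    ([:: 13; 3; 0; 32; 8], [:: 38; 40; 9; 32; 0])]%num.

Lemma good_multipartite_11_4 : good (@multipartite 'I_11 'I_4).
Proof. by apply: (@multipartite_of_cyclic_check 43 44 1 base_multipartite_11_4); vm_compute. Qed.

Definition base_multipartite_11_10 : block_pairs :=
  [:: ([:: 45; 20; 0; 106; 2], [:: 0; 20; 62; 109; 23]);
    ([:: 80; 52; 6; 0; 15], [:: 23; 52; 80; 20; 39]);
    ([:: 5; 0; 46; 32; 100], [:: 6; 108; 11; 32; 46]);
    ([:: 72; 0; 76; 60; 25], [:: 29; 103; 0; 72; 80]);
    ([:: 61; 73; 71; 54; 0], [:: 80; 1; 53; 54; 71])]%num.

Lemma good_multipartite_11_10 : good (@multipartite 'I_11 'I_10).
Proof. by apply: (@multipartite_of_cyclic_check 109 110 1 base_multipartite_11_10); vm_compute. Qed.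

Definition base_multipartite_13_5 : block_pairs :=
  [:: ([:: 29; 6; 36; 50; 0], [:: 36; 6; 60; 26; 12]);
    ([:: 17; 2; 49; 0; 27], [:: 48; 11; 49; 2; 6]);
    ([:: 62; 0; 34; 9; 2], [:: 16; 0; 62; 8; 61])]%num.

Lemma good_multipartite_13_5 : good (@multipartite 'I_13 'I_5).
Proof. by apply: (@multipartite_of_cyclic_check 64 65 1 base_multipartite_13_5); vm_compute. Qed.

(** No symmetry is used: the blocks come in 98 pairs, each covering 20 of the
    [45 * 44 - 5 * 4 = 1960] ordered pairs. *)
Definition base_hole_40 : block_pairs :=
  [:: ([:: 34; 17; 22; 13; 9], [:: 3; 5; 1; 17; 34]);
    ([:: 18; 12; 22; 39; 44], [:: 23; 1; 13; 12; 18]);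
    ([:: 15; 40; 28; 33; 39], [:: 35; 26; 11; 40; 15]);
    ([:: 20; 31; 41; 39; 9], [:: 44; 19; 9; 39; 4]);
    ([:: 40; 11; 25; 37; 2], [:: 19; 13; 22; 25; 11]);
    ([:: 11; 42; 23; 33; 26], [:: 21; 0; 28; 42; 11]);
    ([:: 32; 13; 8; 26; 36], [:: 44; 7; 6; 13; 32]);
    ([:: 12; 20; 2; 36; 5], [:: 43; 26; 21; 20; 12]);
    ([:: 16; 20; 42; 10; 37], [:: 0; 32; 17; 20; 16]);
    ([:: 11; 31; 4; 5; 44], [:: 5; 4; 8; 2; 10]); ([:: 31; 12; 25; 7; 35], [:: 3; 9; 0; 7; 25]);
    ([:: 16; 25; 6; 14; 44], [:: 21; 4; 6; 25; 29]);
    ([:: 28; 35; 0; 14; 43], [:: 36; 26; 4; 14; 0]);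
    ([:: 2; 0; 1; 4; 3], [:: 39; 41; 1; 0; 15]);
    ([:: 29; 22; 37; 8; 19], [:: 5; 36; 37; 22; 30]);
    ([:: 20; 25; 8; 4; 43], [:: 36; 44; 33; 25; 20]);
    ([:: 34; 12; 24; 43; 27], [:: 27; 43; 30; 31; 11]);
    ([:: 18; 42; 38; 1; 6], [:: 9; 24; 38; 42; 20]);
    ([:: 18; 25; 24; 13; 0], [:: 43; 4; 13; 24; 17]);
    ([:: 2; 6; 28; 41; 23], [:: 43; 6; 2; 16; 15]);
    ([:: 40; 13; 35; 23; 19], [:: 3; 23; 35; 28; 24]);
    ([:: 12; 40; 32; 6; 0], [:: 36; 8; 29; 40; 12]);
    ([:: 25; 42; 30; 17; 36], [:: 4; 30; 42; 18; 34]);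
    ([:: 25; 34; 1; 21; 39], [:: 39; 21; 37; 16; 18]);
    ([:: 7; 2; 39; 19; 43], [:: 2; 7; 17; 37; 42]);
    ([:: 32; 38; 27; 19; 44], [:: 14; 41; 2; 38; 32]);
    ([:: 34; 29; 16; 41; 35], [:: 19; 35; 41; 5; 6]);
    ([:: 16; 40; 4; 9; 36], [:: 3; 14; 27; 40; 16]);
    ([:: 31; 17; 28; 8; 1], [:: 1; 8; 42; 25; 16]);
    ([:: 17; 32; 14; 39; 3], [:: 3; 39; 38; 30; 13]);
    ([:: 30; 41; 4; 21; 19], [:: 19; 21; 27; 1; 24]);
    ([:: 31; 16; 13; 38; 2], [:: 36; 41; 28; 13; 16]);
    ([:: 13; 1; 7; 41; 33], [:: 9; 33; 41; 17; 12]);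
    ([:: 6; 22; 33; 36; 43], [:: 43; 36; 35; 7; 1]);
    ([:: 20; 13; 30; 28; 44], [:: 1; 44; 28; 22; 2]);
    ([:: 12; 29; 17; 23; 4], [:: 4; 23; 27; 41; 37]);
    ([:: 20; 34; 18; 40; 3], [:: 5; 32; 24; 40; 18]);
    ([:: 18; 11; 41; 27; 8], [:: 44; 26; 8; 27; 17]);
    ([:: 34; 15; 6; 4; 26], [:: 8; 33; 13; 15; 34]);
    ([:: 34; 31; 30; 32; 33], [:: 39; 6; 12; 31; 34]);
    ([:: 40; 22; 1; 5; 27], [:: 39; 27; 5; 7; 20]);
    ([:: 38; 12; 41; 26; 3], [:: 4; 35; 12; 38; 16]);
    ([:: 40; 30; 38; 24; 8], [:: 6; 1; 30; 40; 20]);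
    ([:: 20; 15; 11; 32; 7], [:: 3; 4; 22; 15; 20]);
    ([:: 38; 22; 7; 14; 4], [:: 41; 7; 22; 29; 18]);
    ([:: 25; 10; 32; 22; 41], [:: 43; 38; 10; 25; 18]);
    ([:: 18; 10; 33; 35; 4], [:: 39; 35; 33; 29; 42]);
    ([:: 29; 10; 44; 1; 36], [:: 27; 0; 13; 10; 29]);
    ([:: 5; 25; 33; 19; 3], [:: 43; 3; 19; 29; 32]);
    ([:: 38; 37; 35; 39; 36], [:: 14; 35; 37; 13; 20]);
    ([:: 10; 0; 8; 23; 39], [:: 39; 23; 17; 25; 40]);
    ([:: 11; 24; 1; 35; 9], [:: 36; 39; 2; 24; 11]);
    ([:: 11; 34; 0; 19; 36], [:: 41; 10; 34; 11; 20]);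
    ([:: 16; 24; 5; 26; 39], [:: 39; 26; 28; 32; 10]);
    ([:: 12; 42; 28; 9; 19], [:: 27; 22; 32; 42; 12]);
    ([:: 15; 25; 38; 23; 9], [:: 26; 9; 23; 22; 6]);
    ([:: 12; 15; 30; 1; 37], [:: 7; 24; 10; 15; 12]);
    ([:: 34; 37; 7; 44; 23], [:: 43; 9; 28; 37; 34]);
    ([:: 42; 29; 24; 7; 3], [:: 44; 14; 24; 29; 34]);
    ([:: 18; 31; 37; 26; 43], [:: 44; 0; 35; 31; 18]);
    ([:: 16; 32; 1; 23; 43], [:: 4; 33; 1; 32; 11]);
    ([:: 17; 24; 2; 33; 44], [:: 3; 26; 33; 2; 18]);
    ([:: 11; 16; 22; 28; 3], [:: 33; 24; 22; 16; 31]);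
    ([:: 20; 1; 14; 19; 26], [:: 26; 19; 7; 16; 34]);
    ([:: 37; 17; 0; 5; 41], [:: 43; 33; 23; 5; 0]);
    ([:: 42; 13; 27; 4; 39], [:: 26; 5; 13; 42; 31]);
    ([:: 16; 12; 33; 21; 8], [:: 3; 8; 21; 41; 31]);
    ([:: 0; 21; 9; 26; 44], [:: 9; 21; 2; 13; 40]);
    ([:: 12; 11; 10; 13; 14], [:: 44; 3; 37; 11; 12]);
    ([:: 11; 38; 17; 21; 43], [:: 36; 19; 17; 38; 31]);
    ([:: 24; 37; 32; 28; 4], [:: 32; 37; 25; 15; 31]);
    ([:: 31; 27; 23; 36; 3], [:: 3; 36; 6; 10; 42]);
    ([:: 18; 30; 5; 23; 14], [:: 19; 14; 23; 15; 42]);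
    ([:: 16; 30; 7; 0; 27], [:: 14; 21; 33; 7; 30]);
    ([:: 6; 7; 8; 9; 5], [:: 23; 8; 7; 38; 11]);
    ([:: 31; 40; 29; 21; 14], [:: 4; 7; 28; 40; 31]);
    ([:: 20; 29; 38; 0; 33], [:: 26; 37; 1; 38; 29]);
    ([:: 37; 33; 27; 14; 9], [:: 27; 33; 28; 6; 38]);
    ([:: 31; 42; 15; 0; 22], [:: 22; 0; 38; 40; 34]);
    ([:: 15; 24; 41; 14; 36], [:: 26; 41; 24; 30; 25]);
    ([:: 29; 25; 28; 27; 26], [:: 14; 28; 25; 5; 12]);
    ([:: 40; 10; 17; 7; 26], [:: 19; 33; 37; 10; 40]);
    ([:: 29; 11; 30; 6; 39], [:: 5; 9; 16; 11; 29]);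
    ([:: 30; 2; 22; 26; 35], [:: 19; 0; 2; 30; 12]);
    ([:: 31; 10; 24; 6; 19], [:: 9; 14; 1; 10; 31]);
    ([:: 20; 22; 24; 21; 23], [:: 36; 23; 21; 32; 34]);
    ([:: 18; 32; 29; 2; 9], [:: 23; 2; 29; 31; 20]);
    ([:: 30; 10; 9; 3; 43], [:: 23; 44; 10; 30; 16]);
    ([:: 20; 17; 6; 27; 35], [:: 14; 6; 17; 11; 18]);
    ([:: 42; 32; 5; 21; 35], [:: 35; 21; 22; 17; 10]);
    ([:: 34; 10; 38; 5; 28], [:: 44; 21; 5; 38; 15]);
    ([:: 15; 10; 2; 27; 21], [:: 35; 27; 2; 34; 25]);
    ([:: 15; 35; 8; 3; 44], [:: 9; 8; 35; 32; 30]);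
    ([:: 29; 15; 13; 5; 43], [:: 28; 17; 30; 15; 29]);
    ([:: 34; 42; 2; 8; 14], [:: 43; 39; 14; 8; 22]);
    ([:: 18; 28; 7; 21; 36], [:: 19; 8; 28; 18; 20]);
    ([:: 15; 18; 16; 17; 19], [:: 36; 9; 27; 18; 15]);
    ([:: 13; 6; 37; 21; 3], [:: 8; 0; 37; 6; 24])]%num.

Lemma good_hole_40 : good (@hole 'I_40 'I_5).
Proof. by apply: (@hole_of_plain_check 44 1 45 base_hole_40); vm_compute. Qed.

(** Orders congruent to 1 modulo 20 are auxiliary: they fill parts of that size, or parts of size
    divisible by 20 with one extra point. *)
Definition base_complete_21 : block_pairs :=
  [:: ([:: 4; 0; 9; 1; 15], [:: 20; 2; 18; 1; 9])]%num.

Lemma good_complete_21 : good (@complete 'I_21).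
Proof. by apply: (@complete_of_check 20 21 1 base_complete_21); vm_compute. Qed.

Definition base_complete_25 : block_pairs :=
  [:: ([:: 18; 17; 15; 4; 0], [:: 15; 17; 6; 21; 14]);
    ([:: 0; 7; 21; 17; 5], [:: 18; 20; 3; 21; 7]);
    ([:: 14; 5; 22; 10; 0], [:: 16; 5; 14; 20; 13]);
    ([:: 24; 11; 0; 12; 19], [:: 8; 2; 0; 11; 18]);
    ([:: 21; 23; 0; 20; 15], [:: 13; 20; 0; 24; 1]);
    ([:: 1; 24; 14; 2; 21], [:: 4; 18; 9; 2; 14]);
    ([:: 1; 5; 18; 19; 16], [:: 16; 19; 17; 8; 23]);
    ([:: 0; 13; 14; 23; 8], [:: 3; 12; 23; 14; 18]);
    ([:: 18; 1; 6; 22; 8], [:: 0; 22; 6; 3; 4]); ([:: 2; 8; 12; 5; 6], [:: 5; 12; 4; 17; 24]);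
    ([:: 6; 20; 17; 19; 2], [:: 9; 17; 20; 18; 12]);
    ([:: 2; 9; 7; 23; 19], [:: 13; 7; 9; 3; 6]); ([:: 19; 3; 9; 1; 0], [:: 15; 10; 3; 19; 5]);
    ([:: 10; 15; 13; 2; 16], [:: 22; 23; 2; 13; 17]);
    ([:: 8; 1; 3; 17; 13], [:: 14; 17; 3; 16; 11]);
    ([:: 24; 23; 16; 4; 3], [:: 18; 10; 11; 23; 24]);
    ([:: 8; 7; 10; 14; 4], [:: 11; 17; 10; 7; 1]); ([:: 4; 5; 23; 1; 7], [:: 6; 15; 1; 23; 11]);
    ([:: 14; 1; 15; 12; 9], [:: 19; 13; 4; 12; 15]);
    ([:: 24; 6; 18; 13; 5], [:: 14; 19; 6; 24; 7]);
    ([:: 23; 10; 21; 6; 12], [:: 13; 19; 21; 10; 18]);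
    ([:: 12; 7; 13; 11; 22], [:: 7; 12; 16; 0; 2]);
    ([:: 6; 0; 16; 9; 10], [:: 21; 8; 9; 16; 24]);
    ([:: 22; 16; 12; 21; 1], [:: 16; 22; 15; 7; 18]);
    ([:: 4; 8; 21; 19; 22], [:: 22; 19; 11; 20; 14]);
    ([:: 24; 10; 17; 9; 22], [:: 20; 23; 22; 9; 5]);
    ([:: 2; 3; 15; 22; 24], [:: 5; 11; 21; 3; 2]);
    ([:: 9; 21; 11; 4; 13], [:: 20; 4; 11; 16; 6]);
    ([:: 2; 1; 4; 20; 10], [:: 12; 3; 10; 20; 8]); ([:: 7; 24; 15; 8; 20], [:: 11; 5; 9; 8; 15])]%num.

Lemma good_complete_25 : good (@complete 'I_25).
Proof. by apply: (@complete_of_check 24 1 25 base_complete_25); vm_compute. Qed.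

Definition base_complete_41 : block_pairs :=
  [:: ([:: 14; 3; 0; 24; 29], [:: 2; 16; 18; 24; 0]); ([:: 0; 1; 12; 19; 32], [:: 8; 1; 0; 36; 4])]%num.

Lemma good_complete_41 : good (@complete 'I_41).
Proof. by apply: (@complete_of_check 40 41 1 base_complete_41); vm_compute. Qed.

Definition base_complete_45 : block_pairs :=
  [:: ([:: 20; 42; 40; 1; 0], [:: 0; 1; 14; 22; 18]);
    ([:: 23; 36; 43; 4; 3], [:: 3; 4; 17; 25; 21]);
    ([:: 26; 39; 37; 7; 6], [:: 6; 7; 11; 19; 24]);
    ([:: 24; 0; 3; 37; 41], [:: 44; 9; 37; 3; 12]);
    ([:: 18; 3; 6; 40; 44], [:: 38; 12; 40; 6; 15]);
    ([:: 21; 6; 0; 43; 38], [:: 41; 15; 43; 0; 9]);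
    ([:: 35; 4; 14; 0; 11], [:: 38; 37; 16; 11; 0]);
    ([:: 29; 7; 17; 3; 14], [:: 41; 40; 10; 14; 3]);
    ([:: 32; 1; 11; 6; 17], [:: 44; 43; 13; 17; 6]);
    ([:: 34; 0; 15; 5; 17], [:: 0; 34; 6; 32; 39]);
    ([:: 28; 3; 9; 8; 11], [:: 3; 28; 0; 35; 42]);
    ([:: 31; 6; 12; 2; 14], [:: 6; 31; 3; 29; 36]);
    ([:: 18; 9; 27; 0; 36], [:: 12; 33; 36; 0; 24]);
    ([:: 21; 12; 30; 3; 39], [:: 15; 27; 39; 3; 18]);
    ([:: 24; 15; 33; 6; 42], [:: 9; 30; 42; 6; 21]);
    ([:: 22; 26; 30; 0; 33], [:: 0; 30; 4; 44; 31]);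
    ([:: 25; 20; 33; 3; 27], [:: 3; 33; 7; 38; 34]);
    ([:: 19; 23; 27; 6; 30], [:: 6; 27; 1; 41; 28]);
    ([:: 25; 23; 0; 29; 28], [:: 42; 36; 27; 23; 25]);
    ([:: 19; 26; 3; 32; 31], [:: 36; 39; 30; 26; 19]);
    ([:: 22; 20; 6; 35; 34], [:: 39; 42; 33; 20; 22]);
    ([:: 20; 23; 13; 9; 44], [:: 14; 6; 4; 23; 20]);
    ([:: 23; 26; 16; 12; 38], [:: 17; 0; 7; 26; 23]);
    ([:: 26; 20; 10; 15; 41], [:: 11; 3; 1; 20; 26]);
    ([:: 26; 24; 9; 14; 43], [:: 34; 42; 41; 24; 26]);
    ([:: 20; 18; 12; 17; 37], [:: 28; 36; 44; 18; 20]);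
    ([:: 23; 21; 15; 11; 40], [:: 31; 39; 38; 21; 23]);
    ([:: 42; 9; 39; 31; 35], [:: 16; 35; 31; 17; 18]);
    ([:: 36; 12; 42; 34; 29], [:: 10; 29; 34; 11; 21]);
    ([:: 39; 15; 36; 28; 32], [:: 13; 32; 28; 14; 24]);
    ([:: 37; 9; 32; 34; 38], [:: 32; 9; 29; 16; 26]);
    ([:: 40; 12; 35; 28; 41], [:: 35; 12; 32; 10; 20]);
    ([:: 43; 15; 29; 31; 44], [:: 29; 15; 35; 13; 23])]%num.

Lemma good_complete_45 : good (@complete 'I_45).
Proof. by apply: (@complete_of_check 44 3 15 base_complete_45); vm_compute. Qed.

Definition base_complete_61 : block_pairs :=
  [:: ([:: 0; 38; 8; 20; 49], [:: 47; 49; 20; 1; 34]);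
    ([:: 34; 10; 57; 0; 3], [:: 3; 0; 28; 24; 22]);
    ([:: 56; 1; 45; 0; 40], [:: 36; 27; 45; 1; 37])]%num.

Lemma good_complete_61 : good (@complete 'I_61).
Proof. by apply: (@complete_of_check 60 61 1 base_complete_61); vm_compute. Qed.

Definition base_complete_65 : block_pairs :=
  [:: ([:: 25; 1; 0; 26; 34], [:: 0; 1; 37; 29; 13]);
    ([:: 2; 0; 50; 60; 47], [:: 35; 0; 2; 32; 20]);
    ([:: 13; 32; 30; 3; 0], [:: 37; 3; 30; 12; 20]);
    ([:: 0; 40; 61; 4; 46], [:: 59; 4; 61; 18; 15]);
    ([:: 0; 44; 43; 55; 5], [:: 54; 5; 55; 20; 15]);
    ([:: 21; 6; 28; 37; 0], [:: 37; 28; 53; 45; 59]);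
    ([:: 22; 14; 53; 0; 52], [:: 40; 44; 7; 0; 53]);
    ([:: 16; 20; 0; 62; 56], [:: 38; 47; 20; 16; 41]);
    ([:: 17; 0; 19; 54; 64], [:: 28; 30; 48; 64; 54]);
    ([:: 18; 41; 59; 36; 0], [:: 59; 41; 42; 12; 7]);
    ([:: 39; 47; 14; 13; 38], [:: 27; 50; 42; 13; 14]);
    ([:: 13; 16; 43; 45; 26], [:: 55; 4; 7; 45; 43]);
    ([:: 13; 19; 41; 50; 34], [:: 51; 27; 21; 41; 19]);
    ([:: 60; 52; 27; 26; 51], [:: 32; 45; 33; 52; 60]);
    ([:: 58; 39; 26; 56; 29], [:: 56; 26; 19; 45; 0]);
    ([:: 54; 63; 47; 32; 26], [:: 63; 54; 9; 18; 25])]%num.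

Lemma good_complete_65 : good (@complete 'I_65).
Proof. by apply: (@complete_of_check 64 13 5 base_complete_65); vm_compute. Qed.

Definition base_complete_81 : block_pairs :=
  [:: ([:: 10; 62; 23; 0; 5], [:: 48; 0; 23; 78; 54]);
    ([:: 63; 35; 19; 4; 0], [:: 0; 4; 73; 20; 64]);
    ([:: 69; 0; 3; 39; 17], [:: 52; 50; 39; 3; 77]);
    ([:: 0; 35; 75; 61; 1], [:: 73; 75; 35; 3; 2])]%num.

Lemma good_complete_81 : good (@complete 'I_81).
Proof. by apply: (@complete_of_check 80 81 1 base_complete_81); vm_compute. Qed.

Definition base_complete_85 : block_pairs :=
  [:: ([:: 61; 46; 51; 0; 1], [:: 50; 43; 56; 1; 0]);
    ([:: 2; 0; 75; 18; 21], [:: 29; 69; 0; 2; 83]);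
    ([:: 57; 83; 3; 0; 68], [:: 78; 65; 43; 83; 57]);
    ([:: 0; 42; 66; 4; 36], [:: 39; 51; 66; 42; 78]);
    ([:: 0; 5; 25; 48; 17], [:: 69; 18; 48; 25; 68]);
    ([:: 65; 52; 0; 6; 30], [:: 48; 4; 0; 52; 63]);
    ([:: 7; 0; 41; 40; 69], [:: 23; 0; 7; 67; 51]);
    ([:: 72; 0; 84; 8; 31], [:: 8; 84; 62; 65; 82]);
    ([:: 0; 22; 56; 32; 55], [:: 18; 70; 81; 56; 22]);
    ([:: 0; 47; 28; 44; 26], [:: 44; 28; 19; 39; 4]);
    ([:: 74; 64; 0; 37; 27], [:: 28; 75; 0; 64; 46]);
    ([:: 0; 71; 39; 77; 35], [:: 18; 30; 71; 0; 9]);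
    ([:: 70; 53; 0; 78; 58], [:: 68; 77; 0; 53; 12]);
    ([:: 63; 17; 68; 78; 18], [:: 35; 15; 36; 78; 68]);
    ([:: 53; 59; 21; 83; 17], [:: 79; 17; 83; 49; 38]);
    ([:: 65; 17; 34; 42; 22], [:: 32; 34; 17; 12; 15]);
    ([:: 69; 47; 17; 23; 82], [:: 23; 17; 58; 9; 54]);
    ([:: 72; 49; 39; 17; 73], [:: 18; 57; 67; 73; 17]);
    ([:: 64; 45; 43; 61; 17], [:: 19; 33; 43; 45; 62]);
    ([:: 51; 82; 34; 59; 39], [:: 17; 64; 39; 59; 48]);
    ([:: 34; 78; 60; 62; 81], [:: 47; 6; 78; 34; 0])]%num.

Lemma good_complete_85 : good (@complete 'I_85).
Proof. by apply: (@complete_of_check 84 17 5 base_complete_85); vm_compute. Qed.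

Definition base_complete_105 : block_pairs :=
  [:: ([:: 12; 7; 6; 3; 14], [:: 81; 27; 7; 12; 48]);
    ([:: 35; 24; 28; 27; 33], [:: 28; 24; 74; 40; 57]);
    ([:: 48; 56; 54; 45; 49], [:: 18; 98; 46; 49; 45]);
    ([:: 75; 70; 77; 69; 66], [:: 77; 70; 13; 78; 47]);
    ([:: 90; 91; 87; 96; 98], [:: 66; 88; 87; 91; 0]);
    ([:: 49; 98; 3; 75; 27], [:: 27; 75; 80; 95; 87]);
    ([:: 48; 70; 14; 24; 96], [:: 66; 14; 70; 20; 12]);
    ([:: 91; 45; 35; 12; 69], [:: 53; 81; 45; 91; 47]);
    ([:: 56; 33; 7; 90; 66], [:: 22; 33; 56; 19; 61]);
    ([:: 54; 87; 6; 77; 28], [:: 79; 28; 77; 67; 59]);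
    ([:: 48; 3; 91; 77; 33], [:: 90; 71; 33; 77; 55]);
    ([:: 24; 54; 7; 98; 69], [:: 65; 30; 54; 24; 44]);
    ([:: 45; 14; 90; 75; 28], [:: 28; 75; 30; 86; 3]);
    ([:: 6; 49; 96; 66; 35], [:: 17; 96; 49; 90; 56]);
    ([:: 56; 12; 87; 70; 27], [:: 27; 70; 88; 100; 46]);
    ([:: 56; 3; 96; 28; 69], [:: 37; 79; 96; 3; 53]);
    ([:: 77; 12; 90; 49; 24], [:: 9; 90; 12; 35; 104]);
    ([:: 45; 98; 6; 70; 33], [:: 33; 70; 99; 73; 97]);
    ([:: 54; 14; 91; 66; 27], [:: 75; 91; 14; 15; 61]);
    ([:: 48; 87; 7; 75; 35], [:: 37; 73; 87; 48; 5]);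
    ([:: 3; 54; 35; 90; 70], [:: 73; 10; 14; 54; 3]);
    ([:: 56; 6; 24; 91; 75], [:: 96; 24; 6; 51; 60]);
    ([:: 7; 45; 77; 96; 27], [:: 93; 40; 103; 45; 7]);
    ([:: 48; 28; 12; 98; 66], [:: 21; 12; 28; 29; 0]);
    ([:: 87; 49; 14; 69; 33], [:: 24; 76; 99; 14; 49]);
    ([:: 42; 84; 0; 63; 21], [:: 89; 22; 40; 0; 84])]%num.

Lemma good_complete_105 : good (@complete 'I_105).
Proof. by apply: (@complete_of_check 104 21 5 base_complete_105); vm_compute. Qed.

(** Here 164 points rotate in four runs of 41, and the point 164 is fixed. *)
Definition base_complete_165 : block_pairs :=
  [:: ([:: 5; 2; 34; 13; 0], [:: 66; 121; 34; 2; 145]);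
    ([:: 116; 46; 0; 43; 136], [:: 28; 30; 46; 116; 124]);
    ([:: 84; 0; 157; 87; 54], [:: 72; 10; 157; 0; 99]);
    ([:: 0; 128; 75; 95; 125], [:: 142; 41; 125; 95; 110]);
    ([:: 54; 46; 2; 41; 75], [:: 6; 20; 2; 46; 128]);
    ([:: 157; 95; 41; 43; 5], [:: 104; 43; 41; 46; 84]);
    ([:: 84; 116; 13; 41; 128], [:: 87; 116; 84; 7; 20]);
    ([:: 136; 125; 34; 41; 87], [:: 41; 34; 35; 45; 85]);
    ([:: 2; 116; 82; 95; 87], [:: 71; 125; 13; 116; 2]);
    ([:: 82; 128; 34; 54; 43], [:: 1; 47; 54; 34; 163]);
    ([:: 5; 84; 82; 136; 75], [:: 63; 75; 136; 149; 122]);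
    ([:: 13; 125; 157; 46; 82], [:: 157; 125; 123; 112; 120]);
    ([:: 136; 128; 123; 157; 2], [:: 107; 100; 125; 128; 136]);
    ([:: 13; 123; 87; 75; 43], [:: 43; 75; 96; 54; 91]);
    ([:: 84; 46; 123; 34; 95], [:: 144; 19; 123; 46; 24]);
    ([:: 5; 116; 123; 125; 54], [:: 154; 54; 125; 67; 106]);
    ([:: 15; 1; 0; 19; 25], [:: 3; 104; 68; 25; 19]);
    ([:: 101; 56; 0; 148; 42], [:: 115; 158; 97; 148; 0]);
    ([:: 0; 97; 66; 142; 83], [:: 66; 97; 51; 131; 16]);
    ([:: 107; 0; 138; 124; 60], [:: 60; 124; 129; 5; 26]);
    ([:: 60; 41; 66; 1; 56], [:: 47; 158; 66; 41; 65]);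
    ([:: 41; 42; 107; 15; 142], [:: 73; 106; 107; 42; 13]);
    ([:: 41; 83; 25; 101; 138], [:: 143; 101; 25; 139; 1]);
    ([:: 148; 19; 41; 97; 124], [:: 132; 101; 97; 41; 40]);
    ([:: 107; 1; 97; 82; 101], [:: 50; 11; 117; 101; 82]);
    ([:: 82; 19; 66; 138; 42], [:: 16; 52; 146; 19; 82]);
    ([:: 60; 15; 148; 83; 82], [:: 52; 22; 15; 60; 156]);
    ([:: 25; 82; 124; 142; 56], [:: 142; 124; 37; 52; 11]);
    ([:: 138; 148; 142; 123; 1], [:: 158; 61; 75; 123; 142]);
    ([:: 25; 97; 123; 60; 42], [:: 108; 95; 13; 97; 25]);
    ([:: 107; 123; 19; 83; 56], [:: 164; 57; 32; 123; 107]);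
    ([:: 66; 101; 123; 15; 124], [:: 123; 101; 111; 84; 76]);
    ([:: 0; 82; 123; 41; 164], [:: 149; 123; 82; 163; 13])]%num.

Lemma good_complete_165 : good (@complete 'I_165).
Proof. by apply: (@complete_of_check 164 41 4 base_complete_165); vm_compute. Qed.

Definition base_complete_185 : block_pairs :=
  [:: ([:: 14; 97; 109; 133; 119], [:: 133; 109; 74; 19; 140]);
    ([:: 16; 1; 170; 92; 173], [:: 93; 69; 64; 92; 170]);
    ([:: 6; 14; 74; 164; 173], [:: 117; 146; 173; 164; 66]);
    ([:: 59; 41; 18; 128; 7], [:: 119; 16; 48; 18; 41]);
    ([:: 36; 53; 47; 15; 135], [:: 111; 7; 62; 53; 36]);
    ([:: 7; 81; 155; 118; 44], [:: 161; 155; 81; 34; 18]);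
    ([:: 155; 99; 94; 54; 55], [:: 118; 13; 55; 54; 18]);
    ([:: 182; 65; 153; 127; 118], [:: 48; 87; 65; 182; 91]);
    ([:: 36; 31; 92; 176; 177], [:: 98; 92; 31; 140; 124]);
    ([:: 160; 54; 184; 117; 127], [:: 127; 117; 104; 80; 10]);
    ([:: 5; 138; 118; 76; 109], [:: 138; 5; 61; 57; 22]);
    ([:: 50; 28; 3; 64; 130], [:: 94; 176; 153; 3; 28]);
    ([:: 71; 38; 100; 80; 152], [:: 62; 162; 100; 38; 110]);
    ([:: 67; 180; 163; 138; 134], [:: 114; 138; 163; 45; 153]);
    ([:: 19; 109; 136; 144; 81], [:: 136; 109; 87; 139; 14]);
    ([:: 46; 162; 181; 147; 121], [:: 122; 142; 162; 46; 158]);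
    ([:: 64; 36; 33; 49; 140], [:: 175; 153; 104; 33; 36]);
    ([:: 156; 37; 179; 120; 132], [:: 79; 179; 37; 66; 107]);
    ([:: 42; 62; 33; 0; 114], [:: 151; 168; 78; 0; 33]);
    ([:: 131; 1; 74; 101; 144], [:: 70; 144; 101; 152; 26]);
    ([:: 22; 106; 114; 107; 146], [:: 89; 146; 107; 27; 135]);
    ([:: 42; 67; 89; 103; 169], [:: 171; 169; 103; 31; 24]);
    ([:: 80; 159; 37; 47; 104], [:: 180; 83; 104; 47; 53]);
    ([:: 29; 12; 168; 101; 172], [:: 57; 101; 168; 89; 43]);
    ([:: 36; 34; 170; 163; 93], [:: 93; 163; 176; 17; 7]);
    ([:: 28; 14; 177; 152; 94], [:: 117; 131; 152; 177; 49]);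
    ([:: 31; 108; 101; 122; 120], [:: 134; 78; 122; 101; 32]);
    ([:: 103; 95; 68; 40; 163], [:: 84; 182; 50; 68; 95]);
    ([:: 10; 4; 92; 157; 178], [:: 136; 4; 10; 53; 37]);
    ([:: 116; 7; 85; 88; 138], [:: 70; 169; 48; 88; 85]);
    ([:: 159; 62; 111; 127; 165], [:: 122; 165; 127; 164; 72]);
    ([:: 72; 164; 159; 120; 119], [:: 159; 164; 95; 30; 31]);
    ([:: 65; 22; 52; 32; 144], [:: 142; 18; 40; 32; 52]);
    ([:: 170; 82; 88; 71; 50], [:: 81; 173; 71; 88; 69]);
    ([:: 55; 0; 28; 63; 123], [:: 152; 87; 181; 28; 0]);
    ([:: 60; 62; 4; 119; 11], [:: 115; 81; 101; 119; 4]);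
    ([:: 11; 24; 166; 103; 176], [:: 147; 72; 24; 11; 62]);
    ([:: 26; 101; 142; 90; 124], [:: 141; 142; 101; 106; 13]);
    ([:: 14; 33; 83; 158; 184], [:: 158; 83; 176; 35; 9]);
    ([:: 106; 41; 38; 91; 182], [:: 145; 10; 38; 41; 25]);
    ([:: 101; 49; 83; 170; 60], [:: 126; 120; 154; 60; 170]);
    ([:: 34; 131; 137; 83; 99], [:: 128; 75; 83; 137; 31]);
    ([:: 3; 2; 42; 47; 140], [:: 115; 21; 42; 2; 68]);
    ([:: 180; 71; 165; 115; 112], [:: 132; 113; 71; 180; 154]);
    ([:: 46; 161; 53; 104; 102], [:: 135; 137; 161; 46; 168]);
    ([:: 37; 163; 165; 114; 144], [:: 136; 168; 114; 165; 42])]%num.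

Lemma good_complete_185 : good (@complete 'I_185).
Proof. by apply: (@complete_of_check 184 37 5 base_complete_185); vm_compute. Qed.

(** * Filling constructions in terms of cardinals *)

Lemma good_complete_sum m z : good (@complete 'I_(m + z)) -> good (@complete ('I_m + 'I_z)%type).
Proof. by apply: good_complete_card; rewrite card_sum !card_ord. Qed.

Lemma good_hole_small m z : z <= 1 -> good (@complete 'I_(m + z)) -> good (@hole 'I_m 'I_z).
Proof. by move=> z1 /good_complete_sum; apply: good_hole_complete; rewrite card_ord. Qed.

Lemma good_fill n m z v : v = n.+1 * m + z -> good (@multipartite 'I_n.+1 'I_m) ->
  good (@hole 'I_m 'I_z) -> good (@complete 'I_(m + z)) -> good (@complete 'I_v).
Proof.
move=> -> gG gH /good_complete_sum gC.
have gG' : good (@multipartite (option 'I_n) 'I_m).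
  by apply: good_multipartite_card gG; rewrite ?card_option !card_ord.
apply: good_complete_card (good_fill_complete gG' gH gC).
by rewrite card_sum card_prod card_option !card_ord.
Qed.

Lemma good_fill0 n m v : v = n.+1 * m ->
  good (@multipartite 'I_n.+1 'I_m) -> good (@complete 'I_m) -> good (@complete 'I_v).
Proof.
move=> e gG gC; have gC0 : good (@complete 'I_(m + 0)) by rewrite addn0.
apply: (@good_fill n m 0 v _ gG (good_hole_small _ gC0) gC0) => //.
by rewrite addn0.
Qed.

Lemma good_fill1 n m v : v = n.+1 * m + 1 ->
  good (@multipartite 'I_n.+1 'I_m) -> good (@complete 'I_(m + 1)) -> good (@complete 'I_v).
Proof. by move=> e gG gC; apply: (@good_fill n m 1 v e gG (good_hole_small _ gC) gC). Qed.

Lemma good_fill_parts u s w z v : v = 5 * (u * w) + s * w + z -> oa 6 u -> s <= u ->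
  good (@multipartite 'I_5 'I_w) -> good (@multipartite 'I_6 'I_w) ->
  good (@hole 'I_(u * w) 'I_z) -> good (@complete 'I_(s * w + z)) -> good (@complete 'I_v).
Proof.
move=> -> oau su g5 g6 gH /good_complete_sum gC.
apply: good_complete_card (good_fill_truncated (truncate_multipartite oau su g5 g6) gH gC).
by rewrite !card_sum card_prod !card_ord.
Qed.

(** Every prime factor of [u] is at least 5, and the field with [p >= 5] elements has [p + 1 >= 6]
    columns to offer; products do the rest. *)
Lemma oa6_coprime u : coprime u 6 -> oa 6 u.
Proof.
elim/ltn_ind: u => u IH cu; case: (ltngtP u 1) => [|u1|->]; last exact: oa1.
  by case: u cu {IH} => // /eqP.
have pp := pdiv_prime u1; have du := pdiv_dvd u.
have cp : coprime (pdiv u) 6 by apply: coprime_dvdl du cu.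
have p5 : 5 <= pdiv u.
  by move: pp cp; case: (pdiv u) => [|[|[|[|[|p]]]]].
rewrite -(divnK du); apply: oa_mul; last first.
  by rewrite -(expn1 (pdiv u)); apply: oa_prime_power; rewrite ?expn1.
apply: IH; first by rewrite ltn_Pdiv ?prime_gt1 // ltnW.
by apply: coprime_dvdl cu; apply: dvdn_div.
Qed.

(** * The recursion on the order *)

Definition attained (k : nat) : Prop := good (@complete 'I_(20 * k + 5)).

(* Parts of sizes [4 (5 m + 1)] and [4 (5 t + 1)], together with one more point. *)
Lemma attained_large m t : oa 6 (5 * m + 1) -> t <= m ->
  attained m -> attained t -> attained (5 * m + 1 + t).
Proof.
move=> oau tm gm gt.
apply: (@good_fill_parts (5 * m + 1) (5 * t + 1) 4 1) oau _ good_multipartite_5_4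
  good_multipartite_6_4 (good_hole_small _ _) _ => //; try lia.
- by rewrite (_ : _ + 1 = 20 * m + 5) //; lia.
- by rewrite (_ : _ + 1 = 20 * t + 5) //; lia.
Qed.

(* Parts of sizes [20 m] and [4 (5 t + 1)], together with one more point. *)
Lemma attained_medium m t : oa 6 (5 * m) -> t < m ->
  good (@complete 'I_(20 * m + 1)) -> attained t -> attained (5 * m + t).
Proof.
move=> oau tm gm gt.
apply: (@good_fill_parts (5 * m) (5 * t + 1) 4 1) oau _ good_multipartite_5_4
  good_multipartite_6_4 (good_hole_small _ _) _ => //; try lia.
- by rewrite (_ : _ * 4 + 1 = 20 * m + 1) //; lia.
- by rewrite (_ : _ + 1 = 20 * t + 5) //; lia.
Qed.

Lemma multipartite_inflate_prime_power n m p k : prime p -> 5 <= (p ^ k).+1 ->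
  good (@multipartite 'I_n 'I_m) -> good (@multipartite 'I_n 'I_(m * p ^ k)).
Proof. by move=> pp pk; apply: inflate_multipartite; apply: oa_prime_power. Qed.

Lemma good_complete_101 : good (@complete 'I_101).
Proof.
apply: (@good_fill1 4 20) => //; last exact: good_complete_21.
exact: (@multipartite_inflate_prime_power 5 4 5 1 isT isT good_multipartite_5_4).
Qed.

Lemma good_complete_121 : good (@complete 'I_121).
Proof.
apply: (@good_fill1 5 20) => //; last exact: good_complete_21.
exact: (@multipartite_inflate_prime_power 6 4 5 1 isT isT good_multipartite_6_4).
Qed.

Lemma good_complete_141 : good (@complete 'I_141).
Proof. exact: (@good_fill1 6 20 _ erefl good_multipartite_7_20 good_complete_21). Qed.

Lemma good_complete_181 : good (@complete 'I_181).
Proof.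
apply: (@good_fill1 8 20) => //; last exact: good_complete_21.
exact: (@multipartite_inflate_prime_power 9 5 2 2 isT isT good_multipartite_9_5).
Qed.

Lemma good_hole_200 : good (@hole 'I_200 'I_5).
Proof.
have gG : good (@multipartite 'I_5 'I_40).
  apply: (@multipartite_inflate_prime_power 5 5 2 3 isT isT).
  exact: (@good_multipartite_prime_power 5 1 isT isT).
apply: good_hole_card (good_fill_hole gG good_hole_40); by rewrite ?card_prod !card_ord.
Qed.

(** The values of [k] up to 56 that lie outside the intervals used in [attained_all]. *)
Definition sporadic : seq nat :=
  iota 1 11 ++ iota 14 3 ++ iota 20 6 ++ [:: 30; 31; 54; 55; 56].

(** Beyond the explicit orders, [20 k + 5] is most often five times a settled order; the other cases
    use more parts, extra points or a truncated group. *)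
Lemma attained_sporadic k : k \in sporadic -> attained k.
Proof.
have K5 p e : prime p -> 5 <= p ^ e -> good (@multipartite 'I_5 'I_(p ^ e)).
  exact: good_multipartite_prime_power.
have inf n m p e : prime p -> 5 <= (p ^ e).+1 ->
  good (@multipartite 'I_n 'I_m) -> good (@multipartite 'I_n 'I_(m * p ^ e)).
  exact: multipartite_inflate_prime_power.
have a1 : attained 1 := good_complete_25.
have a2 : attained 2 := good_complete_45.
have a3 : attained 3 := good_complete_65.
have a4 : attained 4 := good_complete_85.
have a5 : attained 5 := good_complete_105.
have a6 : attained 6 := @good_fill0 4 25 _ erefl (K5 5 2 isT isT) a1.
have a7 : attained 7 := @good_fill1 5 24 _ erefl good_multipartite_6_24 a1.
have a8 : attained 8 := good_complete_165.
have a9 : attained 9 := good_complete_185.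
have a10 : attained 10 := @good_fill0 4 41 _ erefl (K5 41 1 isT isT) good_complete_41.
have a11 : attained 11 := @good_fill0 4 45 _ erefl (inf 5 9 5 1 isT isT (K5 3 2 isT isT)) a2.
have a14 : attained 14.
  exact: (@good_fill 6 40 5 _ erefl (inf 7 10 2 2 isT isT good_multipartite_7_10) good_hole_40 a2).
have a15 : attained 15 := @good_fill0 4 61 _ erefl (K5 61 1 isT isT) good_complete_61.
have a16 : attained 16 := @good_fill0 4 65 _ erefl (inf 5 13 5 1 isT isT (K5 13 1 isT isT)) a3.
have a20 : attained 20 := @good_fill0 4 81 _ erefl (K5 3 4 isT isT) good_complete_81.
have a21 : attained 21 := @good_fill0 4 85 _ erefl (inf 5 17 5 1 isT isT (K5 17 1 isT isT)) a4.
have a22 : attained 22.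
  exact: (@good_fill 10 40 5 _ erefl (inf 11 10 2 2 isT isT good_multipartite_11_10)
            good_hole_40 a2).
(* [465 = 5 * 80 + 64 + 1]: a TD(6, 5) with weight 16 and last group cut to 4 points. *)
have a23 : attained 23.
  apply: (@good_fill_parts 5 4 16 1 _ erefl (@oa_prime_power 6 5 1 isT isT) isT
    (K5 2 4 isT isT) (inf 6 4 2 2 isT isT good_multipartite_6_4) _ a3).
  exact: (@good_hole_small 80 1 isT good_complete_81).
have a24 : attained 24.
  exact: (@good_fill1 10 44 _ erefl (inf 11 4 11 1 isT isT good_multipartite_11_4) a2).
have a25 : attained 25 := @good_fill0 4 101 _ erefl (K5 101 1 isT isT) good_complete_101.
have a30 : attained 30 := @good_fill0 4 121 _ erefl (K5 11 2 isT isT) good_complete_121.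
have a31 : attained 31 := @good_fill0 4 125 _ erefl (K5 5 3 isT isT) a6.
(* [1085 = 5 * 200 + 80 + 5]: a TD(6, 5) with weight 40 and last group cut to 2 points. *)
have a54 : attained 54.
  apply: (@good_fill_parts 5 2 40 5 _ erefl (@oa_prime_power 6 5 1 isT isT) isT
    (inf 5 5 2 3 isT isT (K5 5 1 isT isT)) (inf 6 8 5 1 isT isT good_multipartite_6_8)
    good_hole_200 a4).
have a55 : attained 55.
  exact: (@good_fill0 12 85 _ erefl (inf 13 5 17 1 isT isT good_multipartite_13_5) a4).
have a56 : attained 56.
  exact: (@good_fill0 4 225 _ erefl (inf 5 9 5 2 isT isT (K5 3 2 isT isT)) a11).
by rewrite !inE; do 24?[case/predU1P => [-> //|]]; move/eqP ->.
Qed.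

Lemma attained_all k : 0 < k -> attained k.
Proof.
elim/ltn_ind: k => k IH k0.
(* The interval is the range of [5 m + 1 + t] for [t] from 1 to [m]; both [m] and [t] are below
   [k]. *)
have large m : oa 6 (5 * m + 1) -> 0 < m -> 5 * m + 1 < k <= 6 * m + 1 -> attained k.
  move=> oam m0 km; have -> : k = 5 * m + 1 + (k - (5 * m + 1)) by lia.
  by apply: attained_large => //; [lia|apply: IH; lia|apply: IH; lia].
have medium m : oa 6 (5 * m) -> good (@complete 'I_(20 * m + 1)) -> 5 * m < k < 6 * m -> attained k.
  move=> oam gm km; have -> : k = 5 * m + (k - 5 * m) by lia.
  by apply: attained_medium => //; [lia|apply: IH; lia].
have prime_oa p e : prime p -> 6 <= (p ^ e).+1 -> oa 6 (p ^ e) by exact: oa_prime_power.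
have coprime_oa := oa6_coprime.
have [k_small|k_large] := leqP k 56.
  have [|] := boolP (k \in sporadic); first exact: attained_sporadic.
  move=> ksp; have {ksp} : [|| 12 <= k <= 13, 17 <= k <= 19, 26 <= k <= 29, 32 <= k <= 37,
      38 <= k <= 41, 42 <= k <= 49 | 50 <= k <= 53].
    by move: k0 k_small ksp {IH large medium}; do 57?[case: k => [|k] //].
  case/or4P=> [h|h|h|/or4P[h|h|h|h]].
  - by apply: (large 2); [exact: coprime_oa|lia|lia].
  - by apply: (large 3); [exact: (prime_oa 2 4)|lia|lia].
  - by apply: (medium 5); [exact: (prime_oa 5 2)|exact: good_complete_101|lia].
  - by apply: (large 6); [exact: coprime_oa|lia|lia].
  - by apply: (medium 7); [exact: coprime_oa|exact: good_complete_141|lia].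
  - by apply: (large 8); [exact: coprime_oa|lia|lia].
  - apply: (medium 9); [|exact: good_complete_181|lia].
    exact: oa_mul (prime_oa 3 2 isT isT) (prime_oa 5 1 isT isT).
have [k121|k121] := leqP k 121.
  have : [|| 57 <= k <= 67, 62 <= k <= 73, 72 <= k <= 85, 82 <= k <= 97, 92 <= k <= 109
    | 102 <= k <= 121] by lia.
  case/or4P=> [h|h|h|/or3P[h|h|h]].
  - apply: (large 11); [|lia|lia].
    exact: oa_mul (prime_oa 7 1 isT isT) (prime_oa 2 3 isT isT).
  - by apply: (large 12); [exact: coprime_oa|lia|lia].
  - by apply: (large 14); [exact: coprime_oa|lia|lia].
  - by apply: (large 16); [exact: (prime_oa 3 4)|lia|lia].
  - by apply: (large 18); [exact: coprime_oa|lia|lia].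
  - by apply: (large 20); [exact: coprime_oa|lia|lia].
(* Write [a] for [(k - 2) / 30]. The choices [m = 6 a] and [m = 6 a + 2] make [5 m + 1] equal to
   [30 a + 1] and [30 a + 11], and reach [30 a + 2] to [36 a + 1] and [30 a + 12] to [36 a + 13]. As
   [k > 121] gives [a >= 4], these intervals contain all of [30 a + 2] to [30 a + 31]. *)
have cop a r : r \in [:: 1; 11] -> coprime (30 * a + r) 6.
  move=> hr; rewrite -coprime_modl -modnDml -modnMml mod0n add0n.
  by move: hr; rewrite !inE => /orP[]/eqP ->.
have [r9|r9] := leqP ((k - 2) %% 30) 9.
  apply: (large (6 * ((k - 2) %/ 30))); [|lia|lia].
  by apply: coprime_oa; rewrite mulnA; apply: cop.
apply: (large (6 * ((k - 2) %/ 30) + 2)); [|lia|lia].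
by apply: coprime_oa; rewrite mulnDr mulnA -addnA; apply: cop.
Qed.

Local Open Scope ring_scope.

Theorem theorem3p2 (v : nat) (hmod : v = 5 %[mod 20]) (hv : (5 < v)%N) :
  exists (V : finType) (B : {set 5.-tuple V}),
    [/\ directed_design v B, super_simple B & 1 / 2 <= f v B].
Proof.
have [k k0 vE] : exists2 k, (0 < k)%N & v = (20 * k + 5)%N by exists (v %/ 20)%N; lia.
have gV : good (@complete 'I_v) by rewrite vE; apply: attained_all.
by exists 'I_v; have := good_complete_attains _ gV; rewrite card_ord; apply; lia.
Qed.
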